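(* Let $\mathcal{H}$ be a real Hilbert space, $Q\subset\mathcal{H}$ a nonempty, closed and convex subset, $S:Q\to Q$ a nonexpansive mapping, and $f:Q\to Q$ a contraction with coefficient $\rho\in[0,1[$. Let $\varphi:Q\to\mathbb{R}$ be a $C^1$ convex function such that its gradient $\nabla\varphi:Q\to\mathcal{H}$ is Lipschitz with coefficient $L>0$. Assume that the set $F_{ix}(S)\cap\arg\min_Q\varphi$ is nonempty. Let $\{\alpha_n\}_{n\ge0}\subset]0,1]$, $\{\lambda_n\}_{n\ge0}\subset[0,\frac{2}{L}]$ and $\{e_n\}_{n\ge0}\subset\mathcal{H}$ be three sequences such that: (i) $\alpha_n\to0$ and $\sum_{n=0}^{+\infty}\alpha_n=+\infty$; (ii) $0<\liminf_{n\to+\infty}\lambda_n\le\limsup_{n\to+\infty}\lambda_n<\frac{2}{L}$; (iii) $\frac{\alpha_{n+1}-\alpha_n}{\alpha_n}\to0$ or $\sum_{n=0}^{+\infty}|\alpha_{n+1}-\alpha_n|<\infty$; (iv) $\frac{\lambda_{n+1}-\lambda_n}{\alpha_n}\to0$ or $\sum_{n=0}^{+\infty}|\lambda_{n+1}-\lambda_n|<\infty$; (v) $\frac{\|e_n\|}{\alpha_n}\to0$ or $\sum_{n=0}^{+\infty}\|e_n\|<\infty$. Then for every $z_1\in Q$ the sequence $\{z_n\}$ defined iteratively by $$z_{n+1}=P_Q\big(\alpha_nf(z_n)+(1-\alpha_n)SP_Q(z_n-\lambda_n\nabla\varphi(z_n))+e_n\big),\quad n\ge1,$$ converges strongly in $\mathcal{H}$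 to $q^*$, the unique element of $F_{ix}(S)\cap\arg\min_Q\varphi$ satisfying the variational inequality $$\langle f(q^* )-q^*,x-q^*\rangle\le0$$ for all $x\in F_{ix}(S)\cap\arg\min_Q\varphi$.
   Context: $\mathcal{H}$ has inner product $\langle\cdot,\cdot\rangle$ and associated norm $\|\cdot\|$. Nonexpansive: $\|Sx-Sy\|\le\|x-y\|$ for all $x,y\in Q$. Contraction with coefficient $\rho$: $\|f(x)-f(y)\|\le\rho\|x-y\|$ for all $x,y\in Q$. $F_{ix}(S)=\{x\in Q: Sx=x\}$. $\arg\min_Q\varphi=\{q\in Q:\varphi(q)\le\varphi(x)\ \forall x\in Q\}$. $P_Q:\mathcal{H}\to Q$ is the metric projection onto $Q$. Intervals: $]0,1]$ and $[0,1[$ are half-open. *)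

(* Defs.v *)
From HB Require Import structures.
From mathcomp Require Import all_boot all_order all_algebra.
From mathcomp Require Import all_classical all_reals all_analysis.

Set Implicit Arguments.
Unset Strict Implicit.
Unset Printing Implicit Defensive.

Import Order.TTheory GRing.Theory Num.Theory.
Import numFieldNormedType.Exports.

Local Open Scope classical_set_scope.
Local Open Scope ring_scope.

(* Mappings Q -> Q are total functions stabilizing Q ({fun Q >-> Q}), and
   mappings Q -> R, Q -> H are total functions on H; every notion below only
   looks at their values on Q. *)

Section defs.
Context {R : realType} {H : completeNormedModType R}.
Implicit Types (Q C : set H) (dot : {dot H for idfun}) (phi : H -> R)
  (f g S : H -> H).

Definition nonexpansive Q S :=
  forall x y, Q x -> Q y -> `|S x - S y| <= `|x - y|.

Definition fixed_points Q S : set H := [set x | Q x /\ S x = x].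

Definition argmin Q phi : set H :=
  [set q | Q q /\ forall x, Q x -> phi q <= phi x].

(* Total by convention (default value 0); when H is a Hilbert space and Q is
   nonempty, closed and convex, the set of nearest points is a singleton. *)
Definition metric_proj Q (x : H) : H := xget 0 (argmin Q (fun q => `|x - q|)).

(* The Frechet gradient relative to Q: the limit is taken along y in Q, since
   phi is only given on Q. If the interior of Q is empty, g need not be
   determined by phi. *)
Definition gradient_on dot Q phi g :=
  forall x, Q x ->
    (fun y => phi y - phi x - dot (g x) (y - x) : R^o)
      =o_ (within Q (nbhs x)) (fun y => y - x).

Definition C1_on dot Q phi g :=
  gradient_on dot Q phi g /\ {within Q, continuous g}.

Definition VI_solutions dot C f : set H :=
  [set q | C q /\ forall x, C x -> dot (f q - q) (x - q) <= 0].

End defs.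

(* Main.v *)
Require Import Defs.
From HB Require Import structures.
From mathcomp Require Import all_boot all_order all_algebra.
From mathcomp Require Import all_classical all_reals all_analysis.
From mathcomp Require Import ring lra.

Set Implicit Arguments.
Unset Strict Implicit.
Unset Printing Implicit Defensive.

Import Order.TTheory GRing.Theory Num.Theory.
Import numFieldNormedType.Exports.

Local Open Scope classical_set_scope.
Local Open Scope ring_scope.

(** Let T_lam x = P_Q (x - lam grad phi x). For 0 < lam <= 2 / L this map is
    nonexpansive on Q and its fixed points are the minimizers of phi on Q, so
    the scheme is a viscosity iteration for the maps S o T_{lambda_n}, whose
    common fixed points are sought. The argument has four ingredients.

    Nonexpansiveness of T_lam. The usual proof goes through cocoercivity of the
    gradient (Baillon and Haddad), which is not available here since Q may have
    an empty interior and the gradient is then only meaningful along Q. What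
    survives, and what the projection needs, is the estimate
      <x - y - lam (grad phi x - grad phi y), u - v> <= |x - y| |u - v|
    for x, y, u, v in Q ([gradient_step]). It behaves as if grad phi were
    a symmetric operator with spectrum in [0, L]. Locally it is a combination of
    four Bregman distances of phi ([gradient_step_local]); since the left-hand
    side is additive along a subdivision of the segment from y to x, the local
    estimate propagates to a global one.

    The limit point. The map W = (S + T_mu) / 2, for a small fixed mu, has the
    wanted solution set as fixed point set. Halpern's implicit path
    q_k - W q_k = (u - q_k) / (k + 1) is Cauchy because |u - q_k| is bounded and
    nondecreasing, with |q_k - q_l|^2 <= |u - q_l|^2 - |u - q_k|^2 for k <= l.
    Its limit solves the variational inequality at u, and monotonicity of
    I - W also shows that <u - q, z - q> is almost nonpositive as soon as
    |z - W z| is small ([halpern_limit]). This replaces weak compactness and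
    demiclosedness. Applying it with u = f q, where q is a fixed point of a
    contraction, gives q* ([viscosity_point]).

    Asymptotic regularity. The two alternatives in each of the conditions on
    alpha, lambda and e are both instances of x_n <= alpha_n delta_n + beta_n
    with delta_n -> 0 and beta summable ([negligible]). Errors of this kind
    keep a recursion a_{n+1} <= (1 - gam alpha_n) a_n + x_n bounded and force
    a_n -> 0 ([recursion_bounded], [recursion_vanishing]). Hence z_n is bounded
    and z_{n+1} - z_n -> 0; as T_lam is averaged for lam < 2 / L, it follows that
    z_n - T_{lambda_n} z_n, z_n - S z_n and finally z_n - W z_n tend to 0.

    Conclusion. Now <f q* - q*, z_n - q*> has limit superior at most 0, so
    |z_n - q*|^2 satisfies the recursion above and tends to 0. *)

(** * Inner products *)

Section InnerProduct.
Context {R : realType} {H : completeNormedModType R} (dot : {dot H for idfun}).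

Lemma dotC x y : dot x y = dot y x.
Proof. by rewrite hermC expr0 mul1r. Qed.
Lemma dotDl x y z : dot (x + y) z = dot x z + dot y z.
Proof. exact: linearDl. Qed.
Lemma dotNl x z : dot (- x) z = - dot x z.
Proof. exact: linearNl. Qed.
Lemma dotZl a x z : dot (a *: x) z = a * dot x z.
Proof. exact: linearZl_LR. Qed.
Lemma dotDr x y z : dot z (x + y) = dot z x + dot z y.
Proof. exact: linearDr. Qed.
Lemma dotNr x z : dot z (- x) = - dot z x.
Proof. exact: linearNr. Qed.
Lemma dotZr a x z : dot z (a *: x) = a * dot z x.
Proof. exact: linearZr_LR. Qed.

Definition dot_expand := (dotDl, dotDr, dotNl, dotNr, dotZl, dotZr).

Hypothesis norm_dot : forall x : H, `|x| = Num.sqrt (dot x x).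

Lemma dot_ge0 x : 0 <= dot x x.
Proof.
have [->|/neq0_dnorm_gt0] := eqVneq x 0; first by rewrite (linear0r dot).
by move=> /(_ _ dot)/ltW.
Qed.

Lemma normsqE x : `|x| ^+ 2 = dot x x.
Proof. by rewrite norm_dot sqr_sqrtr// dot_ge0. Qed.

(** Identities between vectors are proved below by testing them against every z,
    which turns them into identities between real numbers. *)
Lemma dot_injl x y : (forall z, dot x z = dot y z) -> x = y.
Proof.
move=> xy; apply/eqP; rewrite -subr_eq0 -normr_eq0 -sqrf_eq0 normsqE.
by rewrite dotDl dotNl xy subrr.
Qed.

Lemma normsqB x y : `|x - y| ^+ 2 = `|x| ^+ 2 - 2 * dot x y + `|y| ^+ 2.
Proof. by rewrite !normsqE !dot_expand (dotC y x); ring. Qed.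

Lemma normsqZ (a : R) (x : H) : `|a *: x| ^+ 2 = a ^+ 2 * `|x| ^+ 2.
Proof. by rewrite !normsqE !dot_expand; ring. Qed.

Lemma cauchy_schwarz x y : dot x y <= `|x| * `|y|.
Proof.
have [->|x0] := eqVneq x 0; first by rewrite (linear0l dot) normr0 mul0r.
have [->|y0] := eqVneq y 0; first by rewrite (linear0r dot) normr0 mulr0.
have := dot_ge0 (`|y| *: x - `|x| *: y).
have xy : 0 < `|x| * `|y| by rewrite mulr_gt0 ?normr_gt0.
rewrite !dot_expand -!normsqE (dotC y x) => le0.
rewrite -(ler_pM2l xy); nra.
Qed.
End InnerProduct.

(** * Projection onto a closed convex set *)

Lemma convex_segment (R : realType) (H : completeNormedModType R) (Q : set H)
    (x y : H) (t : R) :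
  convex_set (Q : set (convex_lmodType H)) ->
  Q x -> Q y -> 0 <= t <= 1 -> Q (x + t *: (y - x)).
Proof.
move=> cQ Qx Qy /andP[t0 t1].
have := cQ y x (Itv01 t0 t1) (mem_set Qy) (mem_set Qx) => /set_mem.
rewrite /conv/=; congr Q.
by rewrite scalerBr scalerBl scale1r addrC addrAC -addrA.
Qed.

Lemma cauchy_tail_cvg (R : realType) (H : completeNormedModType R) (u : nat -> H) :
  (forall e : R, 0 < e -> exists N, forall n, (N <= n)%N -> `|u N - u n| < e) ->
  cvgn u.
Proof.
move=> hu; apply: cauchy_cvg; apply: cauchy_exP => e /hu[N uN].
by exists (u N); exists N => // n; rewrite -ball_normE; exact: uN.
Qed.

Section Projection.
Context {R : realType} {H : completeNormedModType R} (dot : {dot H for idfun}).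
Hypothesis norm_dot : forall x : H, `|x| = Num.sqrt (dot x x).
Variable Q : set H.
Hypotheses (Q_nonempty : Q !=set0) (Q_closed : closed Q)
  (Q_convex : convex_set (Q : set (convex_lmodType H))).

Lemma midpoint_parallelogram (x p q : H) :
  `|p - q| ^+ 2 = 2 * `|x - p| ^+ 2 + 2 * `|x - q| ^+ 2
    - 4 * `|x - (p + 2^-1 *: (q - p))| ^+ 2.
Proof.
rewrite !(normsqE norm_dot) !dot_expand.
rewrite (dotC dot p x) (dotC dot q x) (dotC dot q p); lra.
Qed.

(** A minimizing sequence is Cauchy by the parallelogram identity, since the
    midpoints of its terms stay in Q, hence at distance at least the infimum. *)
Lemma nearest_point_exists (x : H) : exists p, argmin Q (fun q => `|x - q|) p.
Proof.
pose A := [set `|x - q| ^+ 2 | q in Q]; pose d := inf A.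
have Alb : has_lbound A by exists 0 => _ [q _ <-]; rewrite sqr_ge0.
have Ainf : has_inf A.
  by split=> //; case: Q_nonempty => q Qq; exists (`|x - q| ^+ 2); exists q.
have dle q : Q q -> d <= `|x - q| ^+ 2 by move=> Qq; apply: ge_inf => //; exists q.
have /choice[u uP] n : exists q, Q q /\ `|x - q| ^+ 2 < d + harmonic n.
  have [_ [q Qq <-] ?] := inf_adherent (harmonic_gt0 n) Ainf.
  by exists q.
have hle N n : (N <= n)%N -> (harmonic n : R) <= harmonic N.
  by move=> Nn; rewrite lef_pV2 ?posrE ?ler_nat.
have ucvg : cvgn u.
  apply: cauchy_tail_cvg => e e0.
  have e24 : 0 < e ^+ 2 / 4 by rewrite divr_gt0// exprn_gt0.
  (* two terms within e^2 / 4 of the infimum are within e of each other *)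
  have [N _ hN] := (cvgr_lt _ (@cvg_harmonic R)) _ e24.
  exists N; move=> n Nn; rewrite -ltr_sqr ?nnegrE// ?ltW//.
  have [[Qu1 u1] [Qu2 u2]] := (uP N, uP n).
  rewrite (midpoint_parallelogram x).
  have h : 0 <= (2^-1 : R) <= 1 by lra.
  have := dle _ (convex_segment Q_convex Qu1 Qu2 h).
  have := hN N (leqnn N); have := hle _ _ Nn; lra.
exists (limn u); split.
  by apply: (closed_cvg Q) ucvg => //; apply: nearW => n; exact: (uP n).1.
move=> y Qy; rewrite -ler_sqr ?nnegrE//.
have l1 : `|x - u n| * `|x - u n| @[n --> \oo] --> `|x - limn u| * `|x - limn u|.
  by apply: cvgM; apply: cvg_norm; apply: cvgB => //; exact: cvg_cst.
have l2 : d + harmonic n @[n --> \oo] --> d + 0.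
  by apply: cvgD; [exact: cvg_cst|exact: cvg_harmonic].
apply: le_trans (dle _ Qy); rewrite -[leRHS]addr0 expr2.
apply: ler_cvg_to l1 l2 _; apply: nearW => n.
by rewrite -expr2 ltW//; exact: (uP n).2.
Qed.

Lemma metric_projP x : argmin Q (fun q => `|x - q|) (metric_proj Q x).
Proof. by apply: xgetPex; exact: nearest_point_exists. Qed.

Lemma metric_proj_in x : Q (metric_proj Q x).
Proof. exact: (metric_projP x).1. Qed.

Lemma metric_proj_obtuse x y : Q y ->
  dot (x - metric_proj Q x) (y - metric_proj Q x) <= 0.
Proof.
have [] := metric_projP x; set p := metric_proj Q x => Qp pmin Qy.
set c := dot _ _; rewrite leNgt; apply/negP => c0.
have [yp|yp] := eqVneq (`|y - p| ^+ 2) 0.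
  have := cauchy_schwarz norm_dot (x - p) (y - p).
  by move: yp => /eqP; rewrite sqrf_eq0 => /eqP ->; rewrite mulr0 leNgt c0.
have n0 : 0 < `|y - p| ^+ 2 by rewrite lt_neqAle eq_sym yp sqr_ge0.
(* a step t towards y shortens |x - p|^2 by 2 t c - t^2 |y - p|^2 > 0 *)
pose t := Num.min 1 (c / `|y - p| ^+ 2).
have t0 : 0 < t by rewrite lt_min ltr01 divr_gt0.
have t1 : t <= 1 by rewrite ge_min lexx.
have tc : t * `|y - p| ^+ 2 <= c by rewrite -ler_pdivlMr// ge_min lexx orbT.
have t01 : 0 <= t <= 1 by rewrite ltW.
have := pmin _ (convex_segment Q_convex Qp Qy t01).
rewrite -ler_sqr ?nnegrE// opprD addrA.
rewrite (normsqB norm_dot (x - p)) (normsqZ norm_dot) (dotZr dot) -/c => h; nra.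
Qed.

Lemma metric_proj_uniq x p : Q p ->
  (forall y, Q y -> dot (x - p) (y - p) <= 0) -> metric_proj Q x = p.
Proof.
move=> Qp hp; set q := metric_proj Q x.
have h1 := hp q (metric_proj_in x).
have h2 := metric_proj_obtuse x Qp; rewrite -/q in h2.
apply/eqP; rewrite -subr_eq0 -normr_eq0 -sqrf_eq0 eq_le sqr_ge0 andbT.
rewrite (normsqE norm_dot).
move: h1 h2; rewrite !dot_expand (dotC dot q p); lra.
Qed.

Lemma metric_proj_nonexpansive x y :
  `|metric_proj Q x - metric_proj Q y| <= `|x - y|.
Proof.
set p := metric_proj Q x; set q := metric_proj Q y.
have h1 := metric_proj_obtuse x (metric_proj_in y).
have h2 := metric_proj_obtuse y (metric_proj_in x).
have h : `|p - q| ^+ 2 <= `|x - y| * `|p - q|.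
  apply: le_trans (cauchy_schwarz norm_dot _ _); rewrite (normsqE norm_dot).
  rewrite -/p -/q in h1 h2; move: h1 h2.
  rewrite !dot_expand (dotC dot q p); lra.
have [->|pq0] := eqVneq `|p - q| 0; first by [].
by rewrite -(ler_pM2r (x := `|p - q|)) -?expr2// lt_neqAle eq_sym pq0 normr_ge0.
Qed.
End Projection.

(** * Gradient steps on a convex set *)

(** The form in which all limits along a segment (t -> 0) are taken below. *)
Lemma le_of_le_scaledD (R : realType) (a b K : R) :
  (forall t : R, 0 < t <= 1 -> a <= b + t * K) -> a <= b.
Proof.
move=> h; apply/ler_addgt0Pr => e e0.
have K0 : 0 < `|K| + 1 by rewrite ltr_wpDl.
pose t := Num.min 1 (e / (`|K| + 1)).
have t0 : 0 < t by rewrite lt_min ltr01 divr_gt0.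
have t1 : t <= 1 by rewrite ge_min lexx.
have te : t * (`|K| + 1) <= e by rewrite -ler_pdivlMr// ge_min lexx orbT.
have := h t; rewrite t0 t1 => /(_ isT); have := ler_norm K; nra.
Qed.

Section Gradient.
Context {R : realType} {H : completeNormedModType R} (dot : {dot H for idfun}).
Hypothesis norm_dot : forall x : H, `|x| = Num.sqrt (dot x x).
Variable Q : set H.
Hypotheses (Q_nonempty : Q !=set0) (Q_closed : closed Q)
  (Q_convex : convex_set (Q : set (convex_lmodType H))).
Variables (phi : H -> R) (g : H -> H) (L : R).
Hypothesis phi_convex :
  convex_function (Q : set (convex_lmodType H)) (phi : _ -> R^o).
Hypothesis phi_grad : gradient_on dot Q phi g.
Hypotheses (L_gt0 : 0 < L)
  (g_lip : forall x y, Q x -> Q y -> `|g x - g y| <= L * `|x - y|).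

Lemma convex_along_segment x y (t : R) : Q x -> Q y -> 0 <= t <= 1 ->
  phi (x + t *: (y - x)) <= phi x + t * (phi y - phi x).
Proof.
move=> Qx Qy /andP[t0 t1].
have := phi_convex (Itv01 t0 t1) (mem_set Qy) (mem_set Qx).
rewrite /conv/=.
rewrite (_ : t *: y + (1 - t) *: x = x + t *: (y - x)); last first.
  by rewrite scalerBr scalerBl scale1r [RHS]addrC addrAC -addrA.
move=> /le_trans; apply.
suff : t * phi y + (1 - t) * phi x <= phi x + t * (phi y - phi x) by [].
lra.
Qed.

(** The derivative of phi along a segment of Q is only ever used through one small
    t with an arbitrarily small relative error: convexity, or minimality,
    transports the information from that t to the whole segment. *)
Lemma gradient_along_segment x y (e : R) : Q x -> Q y -> 0 < e ->
  exists2 t, 0 < t <= 1 &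
    `|phi (x + t *: (y - x)) - phi x - t * dot (g x) (y - x)| <= t * e.
Proof.
move=> Qx Qy e0; have /eqoP := phi_grad Qx.
have n0 : 0 < `|y - x| + 1 by rewrite ltr_wpDl.
move=> /(_ _ (divr_gt0 e0 n0)); rewrite near_withinE => /nbhs_ballP[d /= d0].
rewrite -ball_normE => hd.
pose t := Num.min 1 (d / 2 / (`|y - x| + 1)).
have t0 : 0 < t by rewrite lt_min ltr01 !divr_gt0.
have t1 : t <= 1 by rewrite ge_min lexx.
have td : t * (`|y - x| + 1) <= d / 2 by rewrite -ler_pdivlMr// ge_min lexx orbT.
have t01 : 0 <= t <= 1 by rewrite ltW.
exists t; first by rewrite t0.
have := hd (x + t *: (y - x)) _ (convex_segment Q_convex Qx Qy t01).
rewrite /= opprD addrA subrr sub0r normrN normrZ (gtr0_norm t0).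
have -> : x + t *: (y - x) - x = t *: (y - x) by rewrite addrAC subrr add0r.
rewrite (dotZr dot) normrZ (gtr0_norm t0) => /(_ _)/le_trans; apply; first nra.
rewrite mulrCA ler_pM2l// mulrAC ler_pdivrMr// ler_pM2l//; lra.
Qed.

(** By convexity the slope of phi between x and y dominates the slope over every
    initial piece of the segment, which is almost the derivative at x. *)
Lemma gradient_inequality x y : Q x -> Q y ->
  phi x + dot (g x) (y - x) <= phi y.
Proof.
move=> Qx Qy; apply/ler_addgt0Pr => e e0.
have [t /andP[t0 t1]] := gradient_along_segment Qx Qy e0.
have t01 : 0 <= t <= 1 by rewrite ltW.
rewrite ler_norml => /andP[h _].
have := convex_along_segment Qx Qy t01 => h2.
rewrite -(ler_pM2l t0); lra.
Qed.

Lemma gradient_at_argmin q x : argmin Q phi q -> Q x -> 0 <= dot (g q) (x - q).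
Proof.
move=> [Qq qmin] Qx; rewrite -lerN2 oppr0; apply/ler_addgt0Pr => e e0.
have [t /andP[t0 t1]] := gradient_along_segment Qq Qx e0.
have t01 : 0 <= t <= 1 by rewrite ltW.
rewrite ler_norml => /andP[_ h].
have := qmin _ (convex_segment Q_convex Qq Qx t01) => h2.
rewrite -(ler_pM2l t0); lra.
Qed.

Lemma dot_gradient_diff x y : Q x -> Q y ->
  dot (g y - g x) (y - x) <= L * `|y - x| ^+ 2.
Proof.
move=> Qx Qy; apply: (le_trans (cauchy_schwarz norm_dot _ _)).
by rewrite expr2 mulrA ler_wpM2r// g_lip.
Qed.

Definition bregman x y := phi y - phi x - dot (g x) (y - x).

Lemma bregman_ge0 x y : Q x -> Q y -> 0 <= bregman x y.
Proof. by move=> Qx Qy; have := gradient_inequality Qx Qy; rewrite /bregman; lra. Qed.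

(** The descent lemma, without integration. If c |y - x|^2 is a valid bound, then
    cutting the segment at its midpoint shows that (c / 2 + L / 4) |y - x|^2 is
    one too; starting from c = L, given by convexity and the Lipschitz bound,
    the constants decrease to the fixed point L / 2. *)
Lemma bregman_le x y : Q x -> Q y -> bregman x y <= L / 2 * `|y - x| ^+ 2.
Proof.
move=> Qx0 Qy0.
have step k : forall x y, Q x -> Q y ->
    bregman x y <= L / 2 * (1 + 2^-1 ^+ k) * `|y - x| ^+ 2.
  elim: k => [|k IH] {Qx0 Qy0}x {}y Qx Qy.
    have := gradient_inequality Qy Qx; have := dot_gradient_diff Qx Qy.
    rewrite expr0 /bregman !dot_expand; lra.
  pose m := x + 2^-1 *: (y - x).
  have Qm : Q m by apply: convex_segment => //; lra.
  have mx : m - x = 2^-1 *: (y - x) by rewrite /m addrAC subrr add0r.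
  have ym : y - m = 2^-1 *: (y - x).
    rewrite /m opprD addrA -{1}(scale1r (y - x)) -scalerBl; congr (_ *: _); lra.
  have := IH _ _ Qx Qm; have := IH _ _ Qm Qy; have := dot_gradient_diff Qx Qm.
  rewrite /bregman mx ym !(normsqZ norm_dot) !(dotZr dot) (dotDl dot) (dotNl dot) (exprS _ k).
  move: (2^-1 ^+ k) => c; lra.
have half : `|2^-1 : R| < 1 by rewrite gtr0_norm//; lra.
have c1 : L / 2 * (1 + 2^-1 ^+ k) * `|y - x| ^+ 2 @[k --> \oo] -->
    L / 2 * (1 + 0) * `|y - x| ^+ 2.
  apply: cvgM; last exact: cvg_cst.
  apply: cvgM; first exact: cvg_cst.
  by apply: cvgD; [exact: cvg_cst|exact: cvg_expr].
rewrite addr0 mulr1 in c1.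
have c2 : bregman x y @[k --> \oo] --> bregman x y by exact: cvg_cst.
by apply: ler_cvg_to c2 c1 _; apply: nearW => k; exact: step.
Qed.

(** With m the midpoint of x and y and p = m + v / 2, p' = m - v / 2, the values of
    phi cancel in a combination of the four Bregman distances from x, y to p, p',
    leaving <g y - g x, v>. The distances from x to p and from y to p' have the
    favourable sign; the other two are at most L / 8 |v - (y - x)|^2, and
    expanding this square produces the missing <y - x, v>. *)
Lemma gradient_step_local (lam : R) x y v : 0 <= lam <= 2 / L ->
  Q x -> Q y ->
  Q (x + 2^-1 *: (y - x) + 2^-1 *: v) -> Q (x + 2^-1 *: (y - x) - 2^-1 *: v) ->
  2 * dot (y - x - lam *: (g y - g x)) v <= `|v| ^+ 2 + `|y - x| ^+ 2.
Proof.
set p := _ + 2^-1 *: v; set p' := _ - 2^-1 *: v.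
move=> /andP[lam0 lamL] Qx Qy Qp Qp'.
have lamL2 : lam * (L / 2) <= 1.
  by rewrite -ler_pdivlMr ?divr_gt0// div1r invf_div.
have yp : p - y = 2^-1 *: (v - (y - x)).
  by apply: (dot_injl norm_dot) => z; rewrite /p !dot_expand; lra.
have xp : p' - x = - (2^-1 *: (v - (y - x))).
  by apply: (dot_injl norm_dot) => z; rewrite /p' !dot_expand; lra.
have b1 := bregman_le Qy Qp; have b2 := bregman_le Qx Qp'.
have b3 := bregman_ge0 Qx Qp; have b4 := bregman_ge0 Qy Qp'.
rewrite yp (normsqZ norm_dot) in b1; rewrite xp normrN (normsqZ norm_dot) in b2.
have four_points : dot (g y - g x) v
    = bregman y p' + bregman x p - bregman y p - bregman x p'.
  have -> : p = p' + v.
    by apply: (dot_injl norm_dot) => z; rewrite /p /p' !dot_expand; lra.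
  by rewrite /bregman !dot_expand; ring.
have nv := normsqB norm_dot v (y - x).
rewrite (dotDl dot) (dotNl dot (lam *: _)) (dotZl dot) four_points (dotC dot (y - x)).
nra.
Qed.

(** Room around x in the single direction w. This takes the place of an interior
    point: it is all that the local estimate needs. *)
Definition tube w x := Q (x + 2^-1 *: w) /\ Q (x - 2^-1 *: w).

Lemma tube_segment w x y (t : R) : tube w x -> tube w y -> 0 <= t <= 1 ->
  tube w (x + t *: (y - x)).
Proof.
move=> [xp xm] [yp ym] t01; split.
- rewrite (_ : _ + _ = x + 2^-1 *: w + t *: (y + 2^-1 *: w - (x + 2^-1 *: w))).
    exact: convex_segment.
  by apply: (dot_injl norm_dot) => z; rewrite !dot_expand; lra.
- rewrite (_ : _ - _ = x - 2^-1 *: w + t *: (y - 2^-1 *: w - (x - 2^-1 *: w))).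
    exact: convex_segment.
  by apply: (dot_injl norm_dot) => z; rewrite !dot_expand; lra.
Qed.

Lemma tube_shrink w x (t : R) : tube w x -> 0 <= t <= 1 -> tube (t *: w) x.
Proof.
move=> [xp xm] t01.
have s01 : 0 <= (1 - t) / 2 <= 1 by lra.
have s02 : 0 <= (1 + t) / 2 <= 1 by lra.
split.
- rewrite (_ : _ + _ = x + 2^-1 *: w + ((1 - t) / 2) *: (x - 2^-1 *: w - (x + 2^-1 *: w))).
    exact: convex_segment.
  by apply: (dot_injl norm_dot) => z; rewrite !dot_expand; lra.
- rewrite (_ : _ - _ = x + 2^-1 *: w + ((1 + t) / 2) *: (x - 2^-1 *: w - (x + 2^-1 *: w))).
    exact: convex_segment.
  by apply: (dot_injl norm_dot) => z; rewrite !dot_expand; lra.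
Qed.

Lemma tube_center w x : tube w x -> Q x.
Proof.
move=> [xp xm].
rewrite (_ : x = x + 2^-1 *: w + 2^-1 *: (x - 2^-1 *: w - (x + 2^-1 *: w))).
  by apply: convex_segment => //; lra.
by apply: (dot_injl norm_dot) => z; rewrite !dot_expand; lra.
Qed.

(** If y is within |w| of x, the local estimate applied to the multiple of w of
    length |y - x| is already the claim. Both sides are additive when the segment
    from x to y is halved, so the restriction on |y - x| can be lifted by doubling. *)
Lemma gradient_step_tube (lam : R) x y w : 0 <= lam <= 2 / L ->
  tube w x -> tube w y ->
  dot (y - x - lam *: (g y - g x)) w <= `|y - x| * `|w|.
Proof.
move=> lamL.
have [->|w0] := eqVneq w 0; first by rewrite (linear0r dot) normr0 mulr0.
have wgt0 : 0 < `|w| by rewrite normr_gt0.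
have short x0 y0 : `|y0 - x0| <= `|w| -> tube w x0 -> tube w y0 ->
    dot (y0 - x0 - lam *: (g y0 - g x0)) w <= `|y0 - x0| * `|w|.
  move=> yx tx ty.
  have [->|xy0] := eqVneq y0 x0.
    by rewrite !subrr scaler0 subr0 (linear0l dot) normr0 mul0r.
  have d0 : 0 < `|y0 - x0| by rewrite normr_gt0 subr_eq0.
  pose t := `|y0 - x0| / `|w|.
  have t0 : 0 < t by rewrite divr_gt0.
  have t1 : t <= 1 by rewrite ler_pdivrMr// mul1r.
  have h01 : 0 <= (2^-1 : R) <= 1 by lra.
  have t01 : 0 <= t <= 1 by rewrite ltW.
  have [mp mm] := tube_shrink (tube_segment tx ty h01) t01.
  have := gradient_step_local lamL (tube_center tx) (tube_center ty) mp mm.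
  have tw : t * `|w| = `|y0 - x0| by rewrite divfK// gt_eqF.
  rewrite (dotZr dot) (normsqZ norm_dot) -exprMn tw -tw => h.
  rewrite -(ler_pM2l t0); lra.
have long k : forall x0 y0, `|y0 - x0| <= 2 ^+ k * `|w| -> tube w x0 -> tube w y0 ->
    dot (y0 - x0 - lam *: (g y0 - g x0)) w <= `|y0 - x0| * `|w|.
  elim: k => [|k IH] x0 y0 yx tx ty; first by apply: short => //; rewrite mul1r in yx.
  pose m := x0 + 2^-1 *: (y0 - x0).
  have tm : tube w m by apply: tube_segment => //; lra.
  have mx : m - x0 = 2^-1 *: (y0 - x0) by rewrite /m addrAC subrr add0r.
  have ym : y0 - m = 2^-1 *: (y0 - x0).
    by apply: (dot_injl norm_dot) => z; rewrite /m !dot_expand; lra.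
  have n2 : `|2^-1 *: (y0 - x0)| = 2^-1 * `|y0 - x0|.
    by rewrite normrZ gtr0_norm//; lra.
  have short_half : 2^-1 * `|y0 - x0| <= 2 ^+ k * `|w| by move: yx; rewrite exprS; lra.
  have := IH x0 m; rewrite mx n2 => /(_ short_half tx tm).
  have := IH m y0; rewrite ym n2 => /(_ short_half tm ty).
  rewrite !dot_expand; lra.
move=> tx ty.
have [k hk] : exists k, `|y - x| <= 2 ^+ k * `|w|.
  exists (Num.trunc (`|y - x| / `|w|)).+1; rewrite -ler_pdivrMr//.
  apply: (le_trans (ltW (truncnS_gt _))).
  by rewrite -natrX ler_nat ltnW// ltn_expl.
exact: long hk tx ty.
Qed.

(** Moving x and y by a factor t towards the midpoint c of u and v creates room of
    size t in the direction u - v; the previous lemma applies to the moved points,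
    and t -> 0 gives the claim by continuity of g. *)
Lemma gradient_step (lam : R) x y u v : 0 <= lam <= 2 / L ->
  Q x -> Q y -> Q u -> Q v ->
  dot (x - y - lam *: (g x - g y)) (u - v) <= `|x - y| * `|u - v|.
Proof.
move=> lamL Qx Qy Qu Qv.
have lam0 : 0 <= lam by case/andP: lamL.
have lamL2 : lam * L <= 2 by rewrite -ler_pdivlMr//; case/andP: lamL.
pose c := v + 2^-1 *: (u - v).
have Qc : Q c by apply: convex_segment => //; lra.
apply: (@le_of_le_scaledD _ _ _ (dot (x - y) (u - v)
   + 2 * (`|c - x| + `|c - y|) * `|u - v|)) => t /andP[t0 t1].
have t01 : 0 <= t <= 1 by rewrite ltW.
have tubeP z : Q z -> tube (t *: (u - v)) (z + t *: (c - z)).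
  move=> Qz; split.
  - have -> : z + t *: (c - z) + 2^-1 *: (t *: (u - v)) = z + t *: (u - z).
      by apply: (dot_injl norm_dot) => w; rewrite /c !dot_expand; lra.
    exact: convex_segment.
  - have -> : z + t *: (c - z) - 2^-1 *: (t *: (u - v)) = z + t *: (v - z).
      by apply: (dot_injl norm_dot) => w; rewrite /c !dot_expand; lra.
    exact: convex_segment.
have Qt z : Q z -> Q (z + t *: (c - z)) by move=> /tubeP/tube_center.
have gt_near z : Q z -> `|g (z + t *: (c - z)) - g z| <= L * (t * `|c - z|).
  move=> Qz; have := g_lip (Qt _ Qz) Qz.
  have -> : z + t *: (c - z) - z = t *: (c - z) by rewrite addrAC subrr add0r.
  by rewrite normrZ (gtr0_norm t0).
have := gradient_step_tube lamL (tubeP _ Qy) (tubeP _ Qx).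
set x' := x + _; set y' := y + _.
have -> : x' - y' = (1 - t) *: (x - y).
  by apply: (dot_injl norm_dot) => w; rewrite /x' /y' !dot_expand; lra.
have s0 : 0 <= 1 - t by lra.
rewrite (dotZr dot) !normrZ (gtr0_norm t0) (ger0_norm s0).
set w := u - v => h.
have h1 := cauchy_schwarz norm_dot (g x' - g x) w.
have h2 := cauchy_schwarz norm_dot (g y - g y') w.
have h3 := gt_near _ Qx; have h4 := gt_near _ Qy.
rewrite -/x' -/y' in h3 h4; rewrite distrC in h4.
have h5 : dot ((1 - t) *: (x - y) - lam *: (g x' - g y')) w <= (1 - t) * `|x - y| * `|w|.
  by rewrite -(ler_pM2l t0); lra.
have h6 : lam * (dot (g x' - g x) w + dot (g y - g y') w)
    <= 2 * (t * `|c - x| + t * `|c - y|) * `|w|.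
  have w0 : 0 <= `|w| by [].
  have h7 : dot (g x' - g x) w + dot (g y - g y') w
     <= L * ((t * `|c - x| + t * `|c - y|) * `|w|).
    apply: le_trans (_ : (L * (t * `|c - x|) + L * (t * `|c - y|)) * `|w| <= _).
      rewrite mulrDl; apply: lerD.
        by apply: (le_trans h1); rewrite ler_wpM2r.
      by apply: (le_trans h2); rewrite ler_wpM2r.
    by rewrite -mulrDr mulrA.
  have sw0 : 0 <= (t * `|c - x| + t * `|c - y|) * `|w|.
    by rewrite mulr_ge0// addr_ge0// mulr_ge0// ltW.
  have := ler_wpM2r sw0 lamL2; have := ler_wpM2l lam0 h7; lra.
have h8 : 0 <= t * (`|x - y| * `|w|) by rewrite !mulr_ge0// ltW.
move: h5 h6; rewrite !dot_expand; lra.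
Qed.

Definition gradient_proj lam x := metric_proj Q (x - lam *: g x).
Local Notation T := gradient_proj.

Lemma gradient_proj_in lam x : Q (T lam x).
Proof. exact: (metric_proj_in norm_dot). Qed.

Lemma gradient_proj_firm lam x y : Q x -> Q y ->
  `|T lam x - T lam y| ^+ 2
    <= dot (x - y - lam *: (g x - g y)) (T lam x - T lam y).
Proof.
move=> Qx Qy.
have h1 := metric_proj_obtuse norm_dot Q_nonempty Q_closed Q_convex
  (x - lam *: g x) (gradient_proj_in lam y).
have h2 := metric_proj_obtuse norm_dot Q_nonempty Q_closed Q_convex
  (y - lam *: g y) (gradient_proj_in lam x).
rewrite -/(T lam x) -/(T lam y) in h1 h2; rewrite (normsqE norm_dot).
by move: h1 h2; rewrite !dot_expand; lra.
Qed.

(** The step x - lam g x is a convex combination, with weight lam L / 2 < 1 on the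
    extreme step 2 / L, of the identity and of the step for 2 / L, for which
    [gradient_step] still holds. The weight left on the identity measures how much
    the map contracts. *)
Lemma gradient_proj_averaged lam x y : 0 <= lam < 2 / L -> Q x -> Q y ->
  `|T lam x - T lam y| ^+ 2 <= `|x - y| ^+ 2
    - (1 - lam * L / 2) * `|x - y - (T lam x - T lam y)| ^+ 2.
Proof.
move=> /andP[lam0 lamL] Qx Qy; have := gradient_proj_firm lam Qx Qy.
set v := T lam x - T lam y; set d := x - y; set G := g x - g y.
have max_step : 0 <= 2 / L <= 2 / L by rewrite lexx divr_ge0// ltW.
have := gradient_step max_step Qx Qy (gradient_proj_in lam x) (gradient_proj_in lam y).
rewrite -/v -/d -/G (normsqB norm_dot d v).
set th := lam * L / 2.
have th0 : 0 <= th by rewrite /th divr_ge0// mulr_ge0// ltW.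
have th1 : th < 1 by rewrite /th -mulrA -ltr_pdivlMr ?divr_gt0// div1r invf_div.
have -> : lam *: G = th *: ((2 / L) *: G).
  by rewrite scalerA /th; congr (_ *: _); field; rewrite gt_eqF.
set B := (2 / L) *: G => h1 h2.
have h3 : th * dot (d - B) v <= th * (`|d| * `|v|) by rewrite ler_wpM2l.
have h4 : 0 <= th * (`|d| - `|v|) ^+ 2 by rewrite mulr_ge0// sqr_ge0.
by move: h2 h3 h4; rewrite !dot_expand; lra.
Qed.

Lemma gradient_proj_nonexpansive lam : 0 <= lam <= 2 / L -> nonexpansive Q (T lam).
Proof.
move=> lamL x y Qx Qy; have h1 := gradient_proj_firm lam Qx Qy.
have h2 := gradient_step lamL Qx Qy (gradient_proj_in lam x) (gradient_proj_in lam y).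
have [->|v0] := eqVneq `|T lam x - T lam y| 0; first by [].
have vgt0 : 0 < `|T lam x - T lam y| by rewrite lt_neqAle eq_sym v0 normr_ge0.
by rewrite -(ler_pM2r vgt0) -expr2; exact: le_trans h2.
Qed.

(** Allows trading the varying steps lambda_n for one fixed step mu below all of
    them. The two obtuse angle inequalities at T_lam x and T_mu x, weighted by mu
    and lam so that g x cancels, give (|a| - |b|) (mu |a| - lam |b|) <= 0 for the
    residuals a, b of lam and mu. *)
Lemma gradient_proj_residual_le mu lam x : 0 < mu <= lam -> Q x ->
  `|x - T mu x| <= `|x - T lam x|.
Proof.
move=> /andP[mu0 mulam] Qx.
have h1 := metric_proj_obtuse norm_dot Q_nonempty Q_closed Q_convex
  (x - lam *: g x) (gradient_proj_in mu x).
have h2 := metric_proj_obtuse norm_dot Q_nonempty Q_closed Q_convex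
  (x - mu *: g x) (gradient_proj_in lam x).
rewrite -/(T lam x) -/(T mu x) in h1 h2.
set a := x - T lam x; set b := x - T mu x.
rewrite (_ : x - _ - _ = a - lam *: g x) in h1; last by rewrite addrAC.
rewrite (_ : T mu x - _ = a - b) in h1; last by rewrite /a/b opprB [RHS]addrC subrKA.
rewrite (_ : x - _ - _ = b - mu *: g x) in h2; last by rewrite addrAC.
rewrite (_ : T lam x - _ = b - a) in h2; last by rewrite /a/b opprB [RHS]addrC subrKA.
clearbody a b.
have lam0 : 0 < lam by exact: lt_le_trans mulam.
have h1' : mu * dot (a - lam *: g x) (a - b) <= 0 by rewrite pmulr_rle0.
have h2' : lam * dot (b - mu *: g x) (b - a) <= 0 by rewrite pmulr_rle0.
have cs := cauchy_schwarz norm_dot a b.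
have h : mu * `|a| ^+ 2 + lam * `|b| ^+ 2 <= (lam + mu) * (`|a| * `|b|).
  apply: (@le_trans _ _ ((lam + mu) * dot a b)); last first.
    by rewrite ler_wpM2l// addr_ge0// ltW.
  rewrite !(normsqE norm_dot); move: h1' h2'.
  by rewrite !dot_expand (dotC dot b a); lra.
rewrite leNgt; apply/negP => ab.
have a0 : 0 <= `|a| by [].
have : 0 < lam * (`|b| - `|a|) by rewrite mulr_gt0// subr_gt0.
have : 0 <= (lam - mu) * `|a| by rewrite mulr_ge0// subr_ge0.
nra.
Qed.

Lemma gradient_proj_lip_step lam mu x :
  `|T lam x - T mu x| <= `|lam - mu| * `|g x|.
Proof.
apply: (le_trans (metric_proj_nonexpansive norm_dot Q_nonempty Q_closed Q_convex _ _)).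
by rewrite opprB addrC subrKA -scalerBl normrZ distrC.
Qed.

Lemma gradient_proj_fix mu q : 0 < mu ->
  Q q /\ T mu q = q <-> argmin Q phi q.
Proof.
move=> mu0; split=> [[Qq Tq]|qmin].
  split=> // x Qx; have := gradient_inequality Qq Qx.
  have := metric_proj_obtuse norm_dot Q_nonempty Q_closed Q_convex (q - mu *: g q) Qx.
  rewrite -/(T mu q) Tq addrAC subrr sub0r (dotNl dot) (dotZl dot) oppr_le0 pmulr_rge0//.
  by lra.
split; first exact: qmin.1.
apply: (metric_proj_uniq norm_dot) => // [|y Qy]; first exact: qmin.1.
rewrite addrAC subrr sub0r (dotNl dot) (dotZl dot) oppr_le0 pmulr_rge0//.
exact: gradient_at_argmin.
Qed.
End Gradient.

(** * The Halpern path of a nonexpansive map *)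

Lemma contraction_fixpoint (R : realType) (H : completeNormedModType R)
    (Q : set H) (h : H -> H) (k : R) :
  closed Q -> Q !=set0 -> 0 <= k < 1 -> (forall x, Q x -> Q (h x)) ->
  (forall x y, Q x -> Q y -> `|h x - h y| <= k * `|x - y|) ->
  exists2 p, Q p & h p = p.
Proof.
move=> Qcl Q0 /andP[k0 k1] hQ hlip.
pose hf := mkfun hQ.
have [|p Qp ph] := @banach_fixed_point R H Q hf _ Qcl Q0.
  by exists (NngNum k0); split => // -[x y] [/= Qx Qy]; exact: hlip.
by exists p.
Qed.

Section HalpernPath.
Context {R : realType} {H : completeNormedModType R} (dot : {dot H for idfun}).
Hypothesis norm_dot : forall x : H, `|x| = Num.sqrt (dot x x).
Variable Q : set H.
Hypotheses (Q_nonempty : Q !=set0) (Q_closed : closed Q)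
  (Q_convex : convex_set (Q : set (convex_lmodType H))).
Variable W : H -> H.
Hypotheses (W_in : forall x, Q x -> Q (W x)) (W_nonexp : nonexpansive Q W)
  (W_fix : fixed_points Q W !=set0).

(** I - W is a monotone operator when W is nonexpansive. *)
Lemma residual_monotone x y : Q x -> Q y -> 0 <= dot (x - W x - (y - W y)) (x - y).
Proof.
move=> Qx Qy.
have cs := cauchy_schwarz norm_dot (W x - W y) (x - y).
have h : `|W x - W y| * `|x - y| <= `|x - y| ^+ 2.
  by rewrite expr2 ler_wpM2r// W_nonexp.
rewrite (_ : _ - _ - _ = x - y - (W x - W y)).
  by rewrite (dotDl dot) (dotNl dot) -(normsqE norm_dot); lra.
by rewrite !opprB !addrA addrAC (addrAC x) [RHS]addrAC.
Qed.

(** q is the fixed point of the contraction x |-> (c u + W x) / (1 + c). *)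
Lemma halpern_point_exists u (c : R) : Q u -> 0 < c ->
  exists q, Q q /\ q - W q = c *: (u - q).
Proof.
move=> Qu c0; have c1 : 0 < 1 + c by rewrite addr_gt0.
pose s := (1 + c)^-1.
have s0 : 0 < s by rewrite invr_gt0.
have s1 : s < 1 by rewrite invf_lt1// ltrDl.
have s01 : 0 <= s <= 1 by rewrite !ltW.
have sc : s * (1 + c) = 1 by rewrite mulVf// gt_eqF.
have [|x Qx|x y Qx Qy|q Qq hq] :=
  @contraction_fixpoint R H Q (fun x => u + s *: (W x - u)) s Q_closed Q_nonempty.
- by rewrite ltW.
- by apply: convex_segment => //; exact: W_in.
- rewrite (_ : _ - _ = s *: (W x - W y)).
    by rewrite normrZ gtr0_norm// ler_wpM2l ?W_nonexp// ltW.
  by apply: (dot_injl norm_dot) => z; rewrite !dot_expand; lra.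
exists q; split => //; apply: (dot_injl norm_dot) => z.
have : dot q z = dot (u + s *: (W q - u)) z by rewrite hq.
rewrite !dot_expand => /(congr1 (fun r => (1 + c) * r)).
have -> : (1 + c) * (dot u z + s * (dot (W q) z - dot u z))
  = (1 + c) * dot u z + s * (1 + c) * (dot (W q) z - dot u z) by ring.
rewrite sc; lra.
Qed.

Lemma halpern_point_VI u c q p : 0 < c -> Q q -> q - W q = c *: (u - q) ->
  fixed_points Q W p -> dot (u - q) (p - q) <= 0.
Proof.
move=> c0 Qq qE [Qp Wp]; have := residual_monotone Qq Qp.
rewrite qE Wp subrr subr0 (dotZl dot) pmulr_rge0// !dot_expand; lra.
Qed.

(** The points q_k with q_k - W q_k = (u - q_k) / (k + 1) converge to the fixed point
    of W nearest to u. The last clause is a quantitative form of demiclosedness of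
    I - W: it is inherited from q_k, for which monotonicity of I - W bounds
    <u - q_k, z - q_k> by (k + 1) |z - W z| |z - q_k|. *)
Lemma halpern_limit u : Q u -> exists q, [/\ fixed_points Q W q,
  forall p, fixed_points Q W p -> dot (u - q) (p - q) <= 0 &
  forall M e : R, 0 < e -> exists2 d, 0 < d & forall z, Q z ->
    `|z - q| <= M -> `|z - W z| <= d -> dot (u - q) (z - q) <= e].
Proof.
move=> Qu.
have /choice[q qP] k : exists q, Q q /\ q - W q = harmonic k *: (u - q).
  exact: halpern_point_exists (harmonic_gt0 k).
have hlt N n : (N < n)%N -> (harmonic n : R) < harmonic N.
  by move=> Nn; rewrite ltf_pV2 ?posrE ?ltr_nat.
pose b k := `|u - q k| ^+ 2.
have step k l : (k <= l)%N -> `|q k - q l| ^+ 2 <= b l - b k.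
  rewrite leq_eqVlt => /predU1P[->|kl]; first by rewrite !subrr normr0 expr0n.
  have [Qk kE] := qP k; have [Ql lE] := qP l.
  have := residual_monotone Qk Ql; rewrite kE lE.
  rewrite (_ : q k - q l = u - q l - (u - q k)); last first.
    by rewrite opprB [RHS]addrC subrKA.
  have := hlt _ _ kl; have := harmonic_gt0 (R := R) l; rewrite /b.
  move: (harmonic k) (harmonic l) (u - q k) (u - q l) => ck cl x y cl0 clk.
  rewrite (normsqB norm_dot) !dot_expand -!(normsqE norm_dot) (dotC dot y x) => h.
  have := sqr_ge0 `|x - y|; rewrite (normsqB norm_dot) => xy.
  have : 0 <= (ck - cl) * (dot x y - `|x| ^+ 2).
    by have := mulr_ge0 (ltW cl0) xy; lra.
  by rewrite pmulr_rge0 ?subr_gt0//; lra.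
have [p pW] := W_fix.
have bM k : b k <= `|u - p| ^+ 2.
  have [Qk kE] := qP k.
  have := halpern_point_VI (harmonic_gt0 k) Qk kE pW.
  rewrite (_ : u - p = u - q k - (p - q k)).
    by rewrite (normsqB norm_dot) /b => h; have := sqr_ge0 `|p - q k|; lra.
  by rewrite opprB addrA subrK.
have bcvg : cvgn b.
  apply: nondecreasing_is_cvgn.
    by move=> k l /step h; rewrite -subr_ge0 (le_trans _ h)// sqr_ge0.
  by exists (`|u - p| ^+ 2) => _ [k _ <-].
have qcvg : cvgn q.
  apply: cauchy_tail_cvg => e e0.
  have : \forall n \near \oo, `|limn b - b n| < e ^+ 2 / 2.
    by apply: (@cvgrPdist_lt _ R^o _ _ _ _ _).1 bcvg _ _; rewrite divr_gt0// exprn_gt0.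
  move=> [N _ hN]; exists N => n Nn.
  rewrite -ltr_sqr ?nnegrE// ?ltW//.
  apply: (le_lt_trans (step _ _ Nn)).
  have := hN _ (leqnn N); have := hN _ Nn; rewrite /= !ltr_norml; lra.
set l := limn q.
have qdist (e : R) : 0 < e -> exists k, `|q k - l| < e /\ harmonic k < e.
  move=> e0; have /cvgrPdist_lt/(_ _ e0)[N _ hN] := qcvg.
  have [N' _ hN'] := cvgr_lt _ (@cvg_harmonic R) _ e0.
  exists (maxn N N'); split; last exact/hN'/leq_maxr.
  by rewrite distrC; exact/hN/leq_maxl.
have Ql : Q l.
  by apply: (closed_cvg Q) qcvg => //; apply: nearW => n; exact: (qP n).1.
have qu k : `|u - q k| <= `|u - p| by rewrite -ler_sqr ?nnegrE//; exact: bM.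
have Wl : W l = l.
  apply: esym; apply/eqP; rewrite -subr_eq0 -normr_le0.
  apply: (@le_of_le_scaledD _ _ _ (2 + `|u - p|)) => t /andP[t0 t1]; rewrite add0r.
  have [k [qkl hk]] := qdist _ t0; have [Qk kE] := qP k.
  have := ler_normD (l - q k) (q k - W (q k) + (W (q k) - W l)).
  have := ler_normD (q k - W (q k)) (W (q k) - W l).
  rewrite !subrKA kE normrZ (gtr0_norm (harmonic_gt0 _)) (distrC l (q k)).
  have := W_nonexp Qk Ql.
  have : harmonic k * `|u - q k| <= t * `|u - p|.
    by apply: ler_pM => //; apply: ltW => //; exact: harmonic_gt0.
  lra.
have main (M e : R) : 0 < e -> exists2 d, 0 < d & forall z, Q z ->
    `|z - l| <= M -> `|z - W z| <= d -> dot (u - l) (z - l) <= e.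
  move=> e0; pose K := `|u - p| + `|M| + 1.
  have K0 : 0 < K by rewrite ltr_wpDl// addr_ge0.
  have M0 : 0 < `|M| + 1 by rewrite ltr_wpDl.
  (* q k within eta of l: replacing l by q k then costs at most e / 2 *)
  pose eta := Num.min 1 (e / 2 / K).
  have eta0 : 0 < eta by rewrite lt_min ltr01 !divr_gt0.
  have eta1 : eta <= 1 by rewrite ge_min lexx.
  have etaK : eta * K <= e / 2 by rewrite -ler_pdivlMr// ge_min lexx orbT.
  have [k [qkl _]] := qdist _ eta0; have [Qk kE] := qP k.
  have c0 : 0 < (harmonic k : R) by exact: harmonic_gt0.
  exists (harmonic k * (e / 2) / (`|M| + 1)) => [|z Qz zM].
    by rewrite !(divr_gt0, mulr_gt0).
  rewrite ler_pdivlMr// => zW.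
  have zqk : `|z - q k| <= `|M| + 1.
    have := ler_normD (z - l) (l - q k); rewrite subrKA (distrC l (q k)).
    by have := ler_norm M; lra.
  have h1 : dot (u - q k) (z - q k) <= e / 2.
    rewrite -(ler_pM2l c0); have := residual_monotone Qk Qz; rewrite kE.
    have := cauchy_schwarz norm_dot (z - W z) (z - q k).
    have : `|z - W z| * `|z - q k| <= `|z - W z| * (`|M| + 1) by rewrite ler_wpM2l.
    by rewrite !dot_expand; lra.
  have h2 := cauchy_schwarz norm_dot (u - q k) (q k - l).
  have h3 := cauchy_schwarz norm_dot (q k - l) (z - l).
  have h4 : `|u - q k| * `|q k - l| <= `|u - p| * eta.
    by apply: ler_pM => //; exact: ltW.
  have h5 : `|q k - l| * `|z - l| <= eta * `|M|.
    by apply: ler_pM => //; [exact: ltW|exact: le_trans (ler_norm _)].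
  by move: h1 h2 h3 h4 h5; rewrite /K in etaK; rewrite !dot_expand; lra.
exists l; split => // p' [Qp' Wp'].
apply/ler_addgt0Pr => e e0; rewrite add0r.
have [d d0] := main `|p' - l| e e0; apply => //.
by rewrite Wp' subrr normr0 ltW.
Qed.
End HalpernPath.

(** * Recursions with negligible perturbations *)

Section Negligible.
Context {R : realType}.
Implicit Types alpha x y a : nat -> R.

(** Perturbations that are either small compared with alpha or summable, and their
    sums; the recursions below tolerate exactly these. *)
Definition negligible alpha x := exists delta beta : nat -> R,
  [/\ delta n @[n --> \oo] --> 0, cvgn (series beta), forall n, 0 <= beta n
    & \forall n \near \oo, x n <= alpha n * delta n + beta n].

Lemma negligible_dichotomy alpha x : (forall n, 0 < alpha n) ->
  (x n / alpha n @[n --> \oo] --> 0 \/ cvgn (series (fun n => `|x n|))) ->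
  negligible alpha (fun n => `|x n|).
Proof.
move=> a0 [h|h].
  exists (fun n => `|x n / alpha n|), (fun=> 0); split => //.
  - by rewrite -[0 in X in _ --> X](@normr0 R R); exact: cvg_norm.
  - rewrite (_ : series _ = fun=> 0); first exact: is_cvg_cst.
    by apply/funext => n; rewrite /series/= big1.
  - apply: nearW => n; rewrite addr0 normrM normfV (gtr0_norm (a0 n)).
    by rewrite mulrCA divff ?mulr1// gt_eqF.
exists (fun=> 0), (fun n => `|x n|); split => //; first exact: cvg_cst.
by apply: nearW => n; rewrite mulr0 add0r.
Qed.

Lemma negligible_vanishing alpha x : x n @[n --> \oo] --> 0 ->
  negligible alpha (fun n => alpha n * x n).
Proof.
move=> x0; exists x, (fun=> 0); split => //; last by apply: nearW => n; rewrite addr0.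
rewrite (_ : series _ = fun=> 0); first exact: is_cvg_cst.
by apply/funext => n; rewrite /series/= big1.
Qed.

Lemma negligible_le alpha x y : (\forall n \near \oo, x n <= y n) ->
  negligible alpha y -> negligible alpha x.
Proof.
move=> xy [d [b [d0 cb b0 h]]]; exists d, b; split => //.
by near=> n; apply: (@le_trans _ _ (y n)); near: n.
Unshelve. all: by end_near. Qed.

Lemma negligibleD alpha x y : negligible alpha x -> negligible alpha y ->
  negligible alpha (fun n => x n + y n).
Proof.
move=> [d [b [d0 cb b0 h]]] [d' [b' [d0' cb' b0' h']]].
exists (d \+ d'), (b \+ b'); split.
- by rewrite -[0 in X in _ --> X](addr0 (0 : R)); exact: cvgD.
- exact: is_cvg_seriesD.
- by move=> n; rewrite addr_ge0.
- near=> n.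
  have h1 : x n <= alpha n * d n + b n by near: n.
  have h2 : y n <= alpha n * d' n + b' n by near: n.
  rewrite /= mulrDr; lra.
Unshelve. all: by end_near. Qed.

Lemma negligibleZ alpha x (K : R) : 0 <= K -> negligible alpha x ->
  negligible alpha (fun n => K * x n).
Proof.
move=> K0 [d [b [d0 cb b0 h]]].
exists (fun n => K * d n), (K *: b); split.
- by rewrite -[0 in X in _ --> X](mulr0 K); apply: cvgM => //; exact: cvg_cst.
- exact: is_cvg_seriesZ.
- by move=> n; rewrite mulr_ge0.
- near=> n.
  have h1 : x n <= alpha n * d n + b n by near: n.
  by rewrite mulrCA -mulrDr ler_wpM2l.
Unshelve. all: by end_near. Qed.

(** Replacing alpha_{n+1} delta_{n+1} by alpha_n delta_{n+1} costs at most
    |alpha_{n+1} - alpha_n|, which is negligible by assumption. *)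
Lemma negligible_shift alpha x : (forall n, 0 < alpha n) ->
  negligible alpha (fun n => `|alpha n.+1 - alpha n|) ->
  negligible alpha x -> negligible alpha (fun n => x n.+1).
Proof.
move=> a0 hvar [d [b [d0 cb b0 h]]].
have dS : d n.+1 @[n --> \oo] --> 0 by rewrite (cvg_shiftS d).
apply: (@negligible_le _ _ (fun n => alpha n * d n.+1
  + (`|alpha n.+1 - alpha n| + b n.+1))).
  have h1 : \forall n \near \oo, `|d n.+1| < 1.
    by have /cvgrPdist_lt/(_ _ ltr01) := dS; apply: filterS => n; rewrite sub0r normrN.
  have h2 : \forall n \near \oo, x n.+1 <= alpha n.+1 * d n.+1 + b n.+1.
    by move: h => [N _ hN]; exists N => // n /= Nn; apply: hN => /=; exact: leqW.
  near=> n.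
  have h3 : `|d n.+1| <= 1 by rewrite ltW//; near: n.
  have h4 : x n.+1 <= alpha n.+1 * d n.+1 + b n.+1 by near: n.
  apply: (le_trans h4); rewrite addrA lerD2r -lerBlDl -mulrBl.
  apply: (le_trans (ler_norm _)); rewrite normrM -[leRHS]mulr1.
  exact: ler_wpM2l.
apply: negligibleD; first exact: negligible_vanishing.
apply: negligibleD => //.
exists (fun=> 0), (fun n => b n.+1); split => //; first exact: cvg_cst.
  rewrite (_ : series _ = fun n => series b n.+1 - b 0%N).
    apply: is_cvgB; last exact: is_cvg_cst.
    by move/cvg_ex : cb => [l bl]; apply/cvg_ex; exists l; rewrite (cvg_shiftS (series b)).
  apply/funext; elim => [|n IH].
    by rewrite seriesSr /series/= !big_geq// add0r subrr.
  by rewrite seriesSr IH [in RHS]seriesSr addrAC.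
by apply: nearW => n; rewrite mulr0 add0r.
Unshelve. all: by end_near. Qed.

Lemma negligible_cvg0 alpha x : alpha n @[n --> \oo] --> 0 ->
  (forall n, 0 <= x n) -> negligible alpha x -> x n @[n --> \oo] --> 0.
Proof.
move=> a0 x0 [d [b [d0 cb b0 h]]].
apply: (@squeeze_cvgr _ _ _ _ (fun=> 0) (fun n => alpha n * d n + b n)).
- by near=> n; rewrite x0/=; near: n.
- exact: cvg_cst.
- rewrite -[0 in X in _ --> X](addr0 (0 : R)) -[X in X + _](mulr0 (0 : R)).
  by apply: cvgD; [exact: cvgM|exact: cvg_series_cvg_0].
Unshelve. all: by end_near. Qed.

Section Recursion.
Variables (alpha a x : nat -> R) (gam : R).
Hypotheses (alpha_itv : forall n, 0 < alpha n <= 1) (gam_itv : 0 < gam <= 1)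
  (x_neg : negligible alpha x).

Lemma series_tail_ge0 (b : nat -> R) N m : (forall n, 0 <= b n) -> (N <= m)%N ->
  series b N <= series b m.
Proof. by move=> b0; apply: nondecreasing_series => n _ _; exact: b0. Qed.

(** Up to the summable part of x, the level C = max (a_N, (K + 1) / gam) is never
    exceeded after a time N from which delta_n <= 1. *)
Lemma recursion_bounded (K : R) :
  (\forall n \near \oo, a n.+1 <= (1 - gam * alpha n) * a n + alpha n * K + x n) ->
  exists M, \forall n \near \oo, a n <= M.
Proof.
have /andP[g0 g1] := gam_itv.
have [d [b [d0 cb b0 hx]]] := x_neg.
have hd : \forall n \near \oo, d n <= 1.
  by have /cvgr_le := d0; apply; exact: ltr01.
move=> ha; have [N _ hN] : \forall n \near \oo,
    a n.+1 <= (1 - gam * alpha n) * a n + alpha n * (K + 1) + b n.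
  near=> n; have /andP[al0 al1] := alpha_itv n.
  have h1 : a n.+1 <= (1 - gam * alpha n) * a n + alpha n * K + x n by near: n.
  have h2 : x n <= alpha n * d n + b n by near: n.
  have h3 : alpha n * d n <= alpha n * 1 by rewrite ler_wpM2l ?(ltW al0)//; near: n.
  lra.
pose C := Num.max (a N) ((K + 1) / gam).
have CK : K + 1 <= gam * C.
  by rewrite mulrC -ler_pdivrMr// le_max lexx orbT.
have claim m : (N <= m)%N -> a m <= C + (series b m - series b N).
  elim: m => [|m IH]; first by rewrite leqn0 => /eqP N0; rewrite /C N0 subrr addr0 le_max lexx.
  rewrite leq_eqVlt => /predU1P[<-|]; first by rewrite subrr addr0 le_max lexx.
  rewrite ltnS => Nm; have /andP[al0 al1] := alpha_itv m.
  have := hN m Nm; have {}IH := IH Nm; rewrite seriesSr.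
  have B0 : 0 <= series b m - series b N by rewrite subr_ge0 series_tail_ge0.
  have k0 : 0 <= 1 - gam * alpha m by nra.
  have := ler_wpM2l k0 IH.
  have := ler_wpM2l (ltW al0) CK.
  have := mulr_ge0 (mulr_ge0 (ltW g0) (ltW al0)) B0.
  lra.
exists (C + (limn (series b) - series b N)); exists N => // m /= Nm.
apply: (le_trans (claim m Nm)); rewrite lerD2l lerD2r.
by apply: nondecreasing_cvgn_le => // i j ij; exact: series_tail_ge0.
Unshelve. all: by end_near. Qed.

(** After a time N, a_m <= a_N / s_m + eps + (a small tail of a series) where
    s_m = 1 + gam (alpha_N + ... + alpha_{m-1}) tends to infinity. Bounding the
    product of the factors 1 - gam alpha_k by 1 / s_m avoids exponentials. *)
Lemma recursion_vanishing : (forall n, 0 <= a n) ->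
  series alpha n @[n --> \oo] --> +oo ->
  (\forall n \near \oo, a n.+1 <= (1 - gam * alpha n) * a n + x n) ->
  a n @[n --> \oo] --> 0.
Proof.
move=> a0 sinf ha; have /andP[g0 g1] := gam_itv.
have [d [b [d0 cb b0 hx]]] := x_neg.
suff main e : 0 < e -> \forall n \near \oo, a n <= e + e + e.
  apply/cvgrPdist_le => e e0; have /main : 0 < e / 3 by rewrite divr_gt0.
  by apply: filterS => n; rewrite sub0r normrN ger0_norm//; lra.
move=> e0.
have hd : \forall n \near \oo, d n <= gam * e.
  by have /cvgr_le := d0; apply; rewrite mulr_gt0.
have hb : \forall n \near \oo, limn (series b) - series b n <= e.
  have /cvgrPdist_le/(_ _ e0) := cb; apply: filterS => n.
  by apply: le_trans; exact: ler_norm.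
have [N _ hN] : \forall n \near \oo,
    a n.+1 <= (1 - gam * alpha n) * a n + alpha n * (gam * e) + b n
    /\ limn (series b) - series b n <= e.
  near=> n; have /andP[al0 al1] := alpha_itv n.
  have h1 : a n.+1 <= (1 - gam * alpha n) * a n + x n by near: n.
  have h2 : x n <= alpha n * d n + b n by near: n.
  have h3 : alpha n * d n <= alpha n * (gam * e) by rewrite ler_wpM2l ?(ltW al0)//; near: n.
  by split; [lra|near: n].
pose s m := 1 + gam * (series alpha m - series alpha N).
have s0 m : (N <= m)%N -> 0 < s m.
  move=> Nm; rewrite ltr_wpDr// mulr_ge0 ?(ltW g0)// subr_ge0 series_tail_ge0//.
  by move=> n; have /andP[/ltW] := alpha_itv n.
have claim m : (N <= m)%N -> a m <= a N / s m + e + (series b m - series b N).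
  elim: m => [|m IH].
    rewrite leqn0 => /eqP N0; rewrite /s N0 !subrr mulr0 !addr0 divr1; lra.
  rewrite leq_eqVlt => /predU1P[<-|].
    by rewrite /s !subrr mulr0 !addr0 divr1; lra.
  rewrite ltnS => Nm; have /andP[al0 al1] := alpha_itv m.
  have [+ _] := hN m Nm; have {}IH := IH Nm; rewrite (seriesSr b).
  have B0 : 0 <= series b m - series b N by rewrite subr_ge0 series_tail_ge0.
  have k0 : 0 <= 1 - gam * alpha m by nra.
  have h2 := ler_wpM2l k0 IH.
  have h4 := mulr_ge0 (mulr_ge0 (ltW g0) (ltW al0)) B0.
  have sm := s0 _ Nm; have sm1 := s0 _ (leqW Nm).
  have sE : s m.+1 = s m + gam * alpha m by rewrite /s seriesSr; ring.
  have h5 : (1 - gam * alpha m) * (a N / s m) <= a N / s m.+1.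
    rewrite mulrCA; apply: ler_wpM2l => //.
    rewrite ler_pdivrMr// [leRHS]mulrC ler_pdivlMr// sE.
    have : 1 <= s m.
      rewrite lerDl mulr_ge0 ?(ltW g0)// subr_ge0 series_tail_ge0//.
      by move=> n; have /andP[/ltW] := alpha_itv n.
    have : 0 <= gam * alpha m by rewrite mulr_ge0// ltW.
    nra.
  lra.
have hs : \forall m \near \oo, a N / s m <= e.
  have h : \forall m \near \oo, series alpha N + a N / e / gam <= series alpha m.
    by have /cvgryPge := sinf; apply.
  near=> m.
  have Nm : (N <= m)%N by near: m; exact: nbhs_infty_ge.
  have : series alpha N + a N / e / gam <= series alpha m by near: m.
  rewrite -lerBrDl ler_pdivrMr// ler_pdivrMr// => h'.
  rewrite ler_pdivrMr ?s0// /s; nra.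
near=> m.
have Nm : (N <= m)%N by near: m; exact: nbhs_infty_ge.
have h1 : a N / s m <= e by near: m.
have [_ h2] := hN N (leqnn N).
have h3 : series b m <= limn (series b).
  by apply: nondecreasing_cvgn_le => // i j ij; exact: series_tail_ge0.
by have := claim m Nm; lra.
Unshelve. all: by end_near. Qed.
End Recursion.
End Negligible.

(** * The viscosity solution *)

Section Viscosity.
Context {R : realType} {H : completeNormedModType R} (dot : {dot H for idfun}).
Hypothesis norm_dot : forall x : H, `|x| = Num.sqrt (dot x x).
Variable Q : set H.
Hypotheses (Q_nonempty : Q !=set0) (Q_closed : closed Q)
  (Q_convex : convex_set (Q : set (convex_lmodType H))).

(** Strict convexity of the norm: if S x and T x, both no farther from p than x is,
    have x as midpoint, the parallelogram identity forces them to coincide. *)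
Lemma fixed_points_average (S T : H -> H) x p :
  nonexpansive Q S -> nonexpansive Q T -> fixed_points Q S p -> fixed_points Q T p ->
  fixed_points Q (fun x => S x + 2^-1 *: (T x - S x)) x ->
  S x = x /\ T x = x.
Proof.
move=> S1 T1 [Qp Sp] [_ Tp] [Qx Wx].
have STx : S x = T x.
  apply/eqP; rewrite -subr_eq0 -normr_eq0 -sqrf_eq0 eq_le sqr_ge0 andbT.
  rewrite (midpoint_parallelogram norm_dot p) Wx.
  have : `|p - S x| ^+ 2 <= `|p - x| ^+ 2.
    by rewrite ler_sqr ?nnegrE// -{1}Sp; exact: S1.
  have : `|p - T x| ^+ 2 <= `|p - x| ^+ 2.
    by rewrite ler_sqr ?nnegrE// -{1}Tp; exact: T1.
  lra.
by move: Wx; rewrite -STx subrr scaler0 addr0.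
Qed.

Variables (f : H -> H) (rho : R).
Hypotheses (f_in : forall x, Q x -> Q (f x)) (rho_itv : 0 <= rho < 1)
  (f_lip : forall x y, Q x -> Q y -> `|f x - f y| <= rho * `|x - y|).

Lemma VI_solutions_unique (C : set H) q q' : C `<=` Q ->
  VI_solutions dot C f q -> VI_solutions dot C f q' -> q = q'.
Proof.
move=> CQ [Cq vq] [Cq' vq']; have := vq _ Cq'; have := vq' _ Cq.
have cs := cauchy_schwarz norm_dot (f q - f q') (q - q').
have fl : `|f q - f q'| * `|q - q'| <= rho * `|q - q'| ^+ 2.
  by rewrite expr2 mulrA ler_wpM2r// f_lip//; exact: CQ.
move=> h1 h2; have h : (1 - rho) * `|q - q'| ^+ 2 <= 0.
  rewrite mulrBl mul1r; move: cs fl h1 h2; rewrite !(normsqE norm_dot) !dot_expand.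
  rewrite (dotC dot q' q); lra.
case/andP: rho_itv => _ rho1.
apply/eqP; rewrite -subr_eq0 -normr_eq0 -sqrf_eq0 eq_le sqr_ge0 andbT.
by move: h; rewrite pmulr_rle0// subr_gt0.
Qed.

Variable W : H -> H.
Hypotheses (W_in : forall x, Q x -> Q (W x)) (W_nonexp : nonexpansive Q W)
  (W_fix : fixed_points Q W !=set0).

(** By the variational inequality the limit of the Halpern path depends on u in a
    nonexpansive way; composed with f it is a contraction, and q is its fixed
    point. *)
Lemma viscosity_point : exists q, VI_solutions dot (fixed_points Q W) f q /\
  forall M e : R, 0 < e -> exists2 d, 0 < d & forall z, Q z ->
    `|z - q| <= M -> `|z - W z| <= d -> dot (f q - q) (z - q) <= e.
Proof.
have /choice[P PP] (u : H) : exists q, Q u -> [/\ fixed_points Q W q,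
  forall p, fixed_points Q W p -> dot (u - q) (p - q) <= 0 &
  forall M e : R, 0 < e -> exists2 d, 0 < d & forall z, Q z ->
    `|z - q| <= M -> `|z - W z| <= d -> dot (u - q) (z - q) <= e].
  have [Qu|nQu] := pselect (Q u); last by exists u.
  have [q hq] := halpern_limit norm_dot Q_nonempty Q_closed Q_convex W_in W_nonexp W_fix Qu.
  by exists q.
have P1 u v : Q u -> Q v -> `|P u - P v| <= `|u - v|.
  move=> Qu Qv; have [Fu vu _] := PP u Qu; have [Fv vv _] := PP v Qv.
  have h1 := vu _ Fv; have h2 := vv _ Fu.
  have cs := cauchy_schwarz norm_dot (u - v) (P u - P v).
  have h : `|P u - P v| ^+ 2 <= `|u - v| * `|P u - P v|.
    apply: le_trans cs; rewrite (normsqE norm_dot).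
    by move: h1 h2; rewrite !dot_expand; lra.
  have [->|n0] := eqVneq `|P u - P v| 0; first by [].
  have ngt0 : 0 < `|P u - P v| by rewrite lt_neqAle eq_sym n0 normr_ge0.
  by rewrite -(ler_pM2r ngt0) -expr2.
have [x Qx|x y Qx Qy|q Qq fq] :=
    contraction_fixpoint (h := P \o f) Q_closed Q_nonempty rho_itv.
- by have [[]] := PP _ (f_in Qx).
- by apply: le_trans (f_lip Qx Qy); apply: P1; exact: f_in.
exists q; have := PP _ (f_in Qq); rewrite /= in fq; rewrite fq => -[Wq vq hq].
by split.
Qed.
End Viscosity.

(** * Convergence of the iteration *)

Lemma near_succ (P : nat -> Prop) :
  (\forall n \near \oo, P n) -> \forall n \near \oo, P n.+1.
Proof. by move=> [N _ hN]; exists N => // n /= Nn; apply: hN => /=; exact: leqW. Qed.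

Lemma near_le_limn_inf (R : realType) (u : nat -> R) (c lo hi : R) :
  (forall n, lo <= u n <= hi) -> c < limn_inf u -> \forall n \near \oo, c <= u n.
Proof.
move=> hu cu.
have lb : has_lbound (range u) by exists lo => _ [n _ <-]; case/andP: (hu n).
have ub : has_ubound (range u) by exists hi => _ [n _ <-]; case/andP: (hu n).
have h : infs u n @[n --> \oo] --> limn_inf u.
  by rewrite /limn_inf (cvg_lim _ (cvg_infs_sup ub lb))//; exact: cvg_infs_sup.
have /cvgr_ge/(_ _ cu) := h; apply: filterS => n /le_trans; apply.
by apply: ge_inf; [exact: has_lbound_sdrop|exists n => /=].
Qed.

Lemma near_ge_limn_sup (R : realType) (u : nat -> R) (c lo hi : R) :
  (forall n, lo <= u n <= hi) -> limn_sup u < c -> \forall n \near \oo, u n <= c.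
Proof.
move=> hu cu.
have lb : has_lbound (range u) by exists lo => _ [n _ <-]; case/andP: (hu n).
have ub : has_ubound (range u) by exists hi => _ [n _ <-]; case/andP: (hu n).
have h : sups u n @[n --> \oo] --> limn_sup u.
  by rewrite /limn_sup (cvg_lim _ (cvg_sups_inf ub lb))//; exact: cvg_sups_inf.
have /cvgr_le/(_ _ cu) := h; apply: filterS => n; apply: le_trans.
by apply: ub_le_sup; [exact: has_ubound_sdrop|exists n => /=].
Qed.

Section Iteration.
Context {R : realType} {H : completeNormedModType R} (dot : {dot H for idfun}).
Hypothesis norm_dot : forall x : H, `|x| = Num.sqrt (dot x x).
Variable Q : set H.
Hypotheses (Q_nonempty : Q !=set0) (Q_closed : closed Q)
  (Q_convex : convex_set (Q : set (convex_lmodType H))).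
Variables (S f : H -> H) (rho : R).
Hypotheses (S_in : forall x, Q x -> Q (S x)) (S_nonexp : nonexpansive Q S).
Hypotheses (rho_itv : 0 <= rho < 1)
  (f_lip : forall x y, Q x -> Q y -> `|f x - f y| <= rho * `|x - y|).
Variables (phi : H -> R) (g : H -> H) (L : R).
Hypothesis phi_convex :
  convex_function (Q : set (convex_lmodType H)) (phi : _ -> R^o).
Hypothesis phi_grad : gradient_on dot Q phi g.
Hypotheses (L_gt0 : 0 < L)
  (g_lip : forall x y, Q x -> Q y -> `|g x - g y| <= L * `|x - y|).
Variables (alpha lambda : nat -> R) (e : nat -> H).
Hypotheses (alpha_itv : forall n, 0 < alpha n <= 1)
  (lambda_itv : forall n, 0 <= lambda n <= 2 / L)
  (alpha_to0 : alpha n @[n --> \oo] --> 0)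
  (alpha_sum : series alpha n @[n --> \oo] --> +oo)
  (alpha_var : negligible alpha (fun n => `|alpha n.+1 - alpha n|))
  (lambda_var : negligible alpha (fun n => `|lambda n.+1 - lambda n|))
  (e_small : negligible alpha (fun n => `|e n|)).
Variables lo hi : R.
Hypotheses (lo_gt0 : 0 < lo) (hi_lt : hi < 2 / L)
  (lambda_near : \forall n \near \oo, lo <= lambda n <= hi).
Variable q : H.
Hypotheses (Sq : fixed_points Q S q) (qmin : argmin Q phi q).
Variable z : nat -> H.
Local Notation T n := (gradient_proj Q g (lambda n)).
Local Notation w n := (S (T n (z n))).
Hypotheses (z1 : Q (z 1%N)) (z_step : forall n, (1 <= n)%N ->
  z n.+1 = metric_proj Q (alpha n *: f (z n) + (1 - alpha n) *: w n + e n)).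

Let T_in n x : Q (T n x).
Proof. exact: (gradient_proj_in norm_dot). Qed.

Let T_nonexp n : nonexpansive Q (T n).
Proof. exact: (gradient_proj_nonexpansive norm_dot Q_nonempty Q_closed
  Q_convex phi_convex phi_grad L_gt0 g_lip). Qed.

Let P_nonexp := metric_proj_nonexpansive norm_dot Q_nonempty Q_closed Q_convex.

Let w_in n : Q (w n). Proof. exact: S_in. Qed.

Lemma iterate_in n : (1 <= n)%N -> Q (z n).
Proof.
case: n => // -[_|n _]; first by [].
by rewrite z_step//; exact: (metric_proj_in norm_dot).
Qed.

Let Qq : Q q. Proof. exact: Sq.1. Qed.

Let Pq : metric_proj Q q = q.
Proof.
apply: (metric_proj_uniq norm_dot) => // y _.
by rewrite subrr (linear0l dot).
Qed.

Let near1 : \forall n \near \oo, (1 <= n)%N.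
Proof. exact: nbhs_infty_ge. Qed.

Lemma near_step_fix : \forall n \near \oo, T n q = q.
Proof.
apply: filterS lambda_near => n /andP[ln _].
have l0 : 0 < lambda n by exact: lt_le_trans ln.
by have [_ /(_ qmin)[]] := gradient_proj_fix norm_dot Q_nonempty Q_closed
  Q_convex phi_convex phi_grad q l0.
Qed.

Lemma near_w_dist : \forall n \near \oo,
  `|w n - q| <= `|T n (z n) - q| /\ `|T n (z n) - q| <= `|z n - q|.
Proof.
near=> n.
have Tq : T n q = q by near: n; exact: near_step_fix.
have n1 : (1 <= n)%N by near: n.
split; first by rewrite -{1}Sq.2; exact: S_nonexp.
by rewrite -{1}Tq; apply: T_nonexp => //; exact: iterate_in.
Unshelve. all: by end_near. Qed.

Lemma near_iterate_dist : \forall n \near \oo,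
  `|z n.+1 - q| <= (1 - (1 - rho) * alpha n) * `|z n - q|
     + alpha n * `|f q - q| + `|e n|.
Proof.
near=> n.
have [w1 w2] : `|w n - q| <= `|T n (z n) - q| /\ `|T n (z n) - q| <= `|z n - q|.
  by near: n; exact: near_w_dist.
have n1 : (1 <= n)%N by near: n.
have /andP[a0 a1] := alpha_itv n.
rewrite z_step// -{1}Pq; apply: (le_trans (P_nonexp _ _)).
have -> : alpha n *: f (z n) + (1 - alpha n) *: w n + e n - q
    = alpha n *: (f (z n) - f q) + alpha n *: (f q - q)
      + (1 - alpha n) *: (w n - q) + e n.
  by apply: (dot_injl norm_dot) => x; rewrite !dot_expand; ring.
apply: (le_trans (ler_normD _ _)); rewrite lerD2r.
apply: (le_trans (ler_normD _ _)).
have := ler_normD (alpha n *: (f (z n) - f q)) (alpha n *: (f q - q)).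
have a2 : 0 <= 1 - alpha n by rewrite subr_ge0.
rewrite !normrZ (gtr0_norm a0) (ger0_norm a2).
have := ler_wpM2l (ltW a0) (f_lip (iterate_in n1) Qq).
have := ler_wpM2l a2 (le_trans w1 w2).
lra.
Unshelve. all: by end_near. Qed.

Let gam_itv : 0 < 1 - rho <= 1.
Proof. by case/andP: rho_itv => r0 r1; lra. Qed.

Lemma iterate_bounded : exists M, \forall n \near \oo, `|z n - q| <= M.
Proof.
exact: (recursion_bounded alpha_itv gam_itv e_small near_iterate_dist).
Qed.

Variable M : R.
Hypothesis zM : \forall n \near \oo, `|z n - q| <= M.

(** Writing the difference of the two arguments of the projection with the weights
    alpha_n, rather than alpha_{n+1}, isolates alpha_{n+1} - alpha_n as a factor of
    terms of index n+1 only. *)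
Lemma step_change_le n : (1 <= n)%N ->
  `|z n.+2 - z n.+1| <= (1 - (1 - rho) * alpha n) * `|z n.+1 - z n|
    + `|f (z n.+1) - w n.+1| * `|alpha n.+1 - alpha n|
    + `|g (z n.+1)| * `|lambda n.+1 - lambda n| + (`|e n.+1| + `|e n|).
Proof.
move=> n1; have n2 := leqW n1; have /andP[a0 a1] := alpha_itv n.
have Qn := iterate_in n1; have Qn1 := iterate_in n2.
rewrite z_step// [in X in _ - X]z_step//; apply: (le_trans (P_nonexp _ _)).
have -> : alpha n.+1 *: f (z n.+1) + (1 - alpha n.+1) *: w n.+1 + e n.+1
    - (alpha n *: f (z n) + (1 - alpha n) *: w n + e n)
    = alpha n *: (f (z n.+1) - f (z n)) + (1 - alpha n) *: (w n.+1 - w n)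
      + (alpha n.+1 - alpha n) *: (f (z n.+1) - w n.+1) + (e n.+1 - e n).
  by apply: (dot_injl norm_dot) => x; rewrite !dot_expand; ring.
have ww : `|w n.+1 - w n| <= `|z n.+1 - z n| + `|g (z n.+1)| * `|lambda n.+1 - lambda n|.
  apply: (le_trans (S_nonexp (T_in _ _) (T_in _ _))).
  rewrite -(subrKA (T n (z n.+1))) addrC; apply: (le_trans (ler_normD _ _)).
  apply: lerD; first exact: T_nonexp.
  rewrite mulrC; exact: (gradient_proj_lip_step norm_dot).
apply: (le_trans (ler_normD _ _)); apply: lerD; last exact: ler_normB.
apply: (le_trans (ler_normD _ _)).
have := ler_normD (alpha n *: (f (z n.+1) - f (z n))) ((1 - alpha n) *: (w n.+1 - w n)).
have a2 : 0 <= 1 - alpha n by rewrite subr_ge0.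
rewrite !normrZ (gtr0_norm a0) (ger0_norm a2).
have := ler_wpM2l (ltW a0) (f_lip Qn1 Qn).
have := ler_wpM2l a2 ww.
have := mulr_ge0 (ltW a0) (mulr_ge0 (normr_ge0 (g (z n.+1)))
  (normr_ge0 (lambda n.+1 - lambda n))).
lra.
Qed.

Let M_ge0 : 0 <= M.
Proof. by have [n h] := filter_ex zM; apply: le_trans h. Qed.

Let near_fw : \forall n \near \oo, `|f (z n) - w n| <= `|f q - q| + 2 * M.
Proof.
near=> n.
have n1 : (1 <= n)%N by near: n.
have [w1 w2] : `|w n - q| <= `|T n (z n) - q| /\ `|T n (z n) - q| <= `|z n - q|.
  by near: n; exact: near_w_dist.
have zn : `|z n - q| <= M by near: n.
have := ler_normD (f (z n) - f q) (f q - q - (w n - q)).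
have := ler_normB (f q - q) (w n - q).
have -> : f (z n) - f q + (f q - q - (w n - q)) = f (z n) - w n.
  by apply: (dot_injl norm_dot) => x; rewrite !dot_expand; ring.
have := f_lip (iterate_in n1) Qq.
have : rho * `|z n - q| <= `|z n - q| by case/andP: rho_itv => r0 r1; rewrite ler_piMl// ltW.
lra.
Unshelve. all: by end_near. Qed.

Let near_g : \forall n \near \oo, `|g (z n)| <= `|g q| + L * M.
Proof.
near=> n.
have n1 : (1 <= n)%N by near: n.
have zn : `|z n - q| <= M by near: n.
have := ler_normD (g (z n) - g q) (g q); rewrite subrK.
have := g_lip (iterate_in n1) Qq.
have := ler_wpM2l (ltW L_gt0) zn.
lra.
Unshelve. all: by end_near. Qed.

Lemma asymptotic_regularity : `|z n.+1 - z n| @[n --> \oo] --> 0.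
Proof.
have a0 n : 0 < alpha n by case/andP: (alpha_itv n).
pose K1 := `|f q - q| + 2 * M; pose K2 := `|g q| + L * M.
have K1_ge0 : 0 <= K1 by rewrite addr_ge0// mulr_ge0.
have K2_ge0 : 0 <= K2 by rewrite addr_ge0// mulr_ge0// ltW.
have xneg : negligible alpha (fun n => K1 * `|alpha n.+1 - alpha n|
    + K2 * `|lambda n.+1 - lambda n| + (`|e n.+1| + `|e n|)).
  apply: negligibleD; last first.
    by apply: negligibleD => //; exact: (negligible_shift a0 alpha_var e_small).
  by apply: negligibleD; exact: negligibleZ.
apply: (recursion_vanishing alpha_itv gam_itv xneg) => //.
near=> n.
have n1 : (1 <= n)%N by near: n.
have h1 : `|f (z n.+1) - w n.+1| <= K1 by near: n; exact: (near_succ near_fw).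
have h2 : `|g (z n.+1)| <= K2 by near: n; exact: (near_succ near_g).
apply: (le_trans (step_change_le n1)).
rewrite -!addrA lerD2l !addrA !lerD2r; apply: lerD; exact: ler_wpM2r.
Unshelve. all: by end_near. Qed.

Let e_to0 : `|e n| @[n --> \oo] --> 0.
Proof. exact: (negligible_cvg0 alpha_to0 _ e_small). Qed.

Lemma iterate_w_dist : `|z n - w n| @[n --> \oo] --> 0.
Proof.
pose K1 := `|f q - q| + 2 * M.
apply: (@squeeze_cvgr _ _ _ _ (fun=> 0)
  (fun n => `|z n.+1 - z n| + (alpha n * K1 + `|e n|))).
- near=> n; rewrite normr_ge0/=.
  have n1 : (1 <= n)%N by near: n.
  have h1 : `|f (z n) - w n| <= K1 by near: n; exact: near_fw.
  have /andP[a0 a1] := alpha_itv n.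
  rewrite (distrC (z n.+1)) -(subrKA (z n.+1)).
  apply: (le_trans (ler_normD _ _)); rewrite lerD2l.
  rewrite z_step// -[X in _ - X](_ : metric_proj Q (w n) = w n); last first.
    apply: (metric_proj_uniq norm_dot) => // y _.
    by rewrite subrr (linear0l dot).
  apply: (le_trans (P_nonexp _ _)).
  have -> : alpha n *: f (z n) + (1 - alpha n) *: w n + e n - w n
      = alpha n *: (f (z n) - w n) + e n.
    by apply: (dot_injl norm_dot) => x; rewrite !dot_expand; ring.
  apply: (le_trans (ler_normD _ _)); rewrite lerD2r normrZ (gtr0_norm a0).
  by rewrite ler_wpM2l// ltW.
- exact: cvg_cst.
- rewrite -[0 in X in _ --> X](addr0 (0 : R)).
  apply: cvgD; first exact: asymptotic_regularity.
  rewrite -[0 in X in _ --> X](addr0 (0 : R)) -[X in X + _](mul0r K1).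
  by apply: cvgD => //; apply: cvgM => //; exact: cvg_cst.
Unshelve. all: by end_near. Qed.

(** The part lost by the averaged map T_n on |z_n - q| is regained, up to
    |z_n - w_n| -> 0, when passing from w_n back to z_n; so the loss vanishes. *)
Lemma iterate_step_dist : `|z n - T n (z n)| @[n --> \oo] --> 0.
Proof.
have c0 : 0 < 1 - hi * L / 2.
  by rewrite subr_gt0 ltr_pdivrMr// mul1r -ltr_pdivlMr.
pose K := 2 * M / (1 - hi * L / 2).
have sq0 : `|z n - T n (z n)| ^+ 2 @[n --> \oo] --> 0.
  apply: (@squeeze_cvgr _ _ _ _ (fun=> 0) (fun n => K * `|z n - w n|)).
  - near=> n; rewrite sqr_ge0/=.
    have n1 : (1 <= n)%N by near: n.
    have Tq : T n q = q by near: n; exact: near_step_fix.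
    have zn : `|z n - q| <= M by near: n.
    have [w1 w2] : `|w n - q| <= `|T n (z n) - q| /\ `|T n (z n) - q| <= `|z n - q|.
      by near: n; exact: near_w_dist.
    have /andP[l1 l2] : lo <= lambda n <= hi by near: n.
    have l3 : 0 <= lambda n < 2 / L.
      by rewrite (le_trans (ltW lo_gt0) l1) (le_lt_trans l2 hi_lt).
    have := gradient_proj_averaged norm_dot Q_nonempty Q_closed Q_convex
      phi_convex phi_grad L_gt0 g_lip l3 (iterate_in n1) Qq.
    rewrite Tq; set y := T n (z n).
    have -> : z n - q - (y - q) = z n - y by rewrite opprB addrA subrK.
    have h1 : (1 - hi * L / 2) * `|z n - y| ^+ 2 <= (1 - lambda n * L / 2) * `|z n - y| ^+ 2.
      by apply: ler_wpM2r; [exact: sqr_ge0|have := ler_wpM2r (ltW L_gt0) l2; lra].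
    have h2 : `|z n - q| <= `|z n - w n| + `|y - q|.
      by rewrite -(subrKA (w n)) (le_trans (ler_normD _ _))// lerD2l.
    have h3 : `|z n - q| ^+ 2 - `|y - q| ^+ 2 <= 2 * M * `|z n - w n|.
      have h4 : 0 <= `|z n - q| + `|y - q| by rewrite addr_ge0.
      have h5 : `|z n - q| - `|y - q| <= `|z n - w n| by lra.
      have h6 : `|z n - q| + `|y - q| <= 2 * M by rewrite -/y in w2; lra.
      have := ler_wpM2r h4 h5; have := ler_wpM2l (normr_ge0 (z n - w n)) h6.
      lra.
    move=> h7; rewrite /K mulrAC ler_pdivlMr// mulrC; lra.
  - exact: cvg_cst.
  - rewrite -[0 in X in _ --> X](mulr0 K).
    by apply: cvgM; [exact: cvg_cst|exact: iterate_w_dist].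
apply/cvgrPdist_lt => d d0.
have /cvgrPdist_lt/(_ _ (exprn_gt0 2 d0)) := sq0; apply: filterS => n.
by rewrite !sub0r !normrN !ger0_norm ?sqr_ge0// ltr_sqr ?nnegrE// ltW.
Unshelve. all: by end_near. Qed.

Let W x := S x + 2^-1 *: (gradient_proj Q g lo x - S x).

Lemma iterate_residual : `|z n - W (z n)| @[n --> \oo] --> 0.
Proof.
apply: (@squeeze_cvgr _ _ _ _ (fun=> 0)
  (fun n => `|z n - T n (z n)| + `|z n - w n|)).
- near=> n; rewrite normr_ge0/=.
  have n1 : (1 <= n)%N by near: n.
  have Qn := iterate_in n1.
  have /andP[l1 l2] : lo <= lambda n <= hi by near: n.
  have h1 : `|z n - gradient_proj Q g lo (z n)| <= `|z n - T n (z n)|.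
    apply: (gradient_proj_residual_le norm_dot) => //.
    by rewrite lo_gt0.
  have h2 : `|z n - S (z n)| <= `|z n - w n| + `|z n - T n (z n)|.
    rewrite -(subrKA (w n)) (le_trans (ler_normD _ _))// lerD2l.
    by rewrite [leRHS]distrC; exact: S_nonexp.
  have -> : z n - W (z n)
      = 2^-1 *: (z n - gradient_proj Q g lo (z n)) + 2^-1 *: (z n - S (z n)).
    by apply: (dot_injl norm_dot) => x; rewrite /W !dot_expand; lra.
  apply: (le_trans (ler_normD _ _)); rewrite !normrZ (gtr0_norm (_ : 0 < 2^-1)) ?invr_gt0//.
  have := normr_ge0 (z n - w n); lra.
- exact: cvg_cst.
- rewrite -[0 in X in _ --> X](addr0 (0 : R)).
  by apply: cvgD; [exact: iterate_step_dist|exact: iterate_w_dist].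
Unshelve. all: by end_near. Qed.

Hypothesis q_viscosity : forall M e : R, 0 < e -> exists2 d, 0 < d &
  forall x, Q x -> `|x - q| <= M -> `|x - W x| <= d -> dot (f q - q) (x - q) <= e.

Lemma iterate_VI_limit : Num.max 0 (dot (f q - q) (z n.+1 - q)) @[n --> \oo] --> 0.
Proof.
apply/cvgrPdist_le => d d0.
have [r r0 hr] := q_viscosity M d0.
have hW : \forall n \near \oo, `|z n - W (z n)| <= r.
  have /cvgrPdist_le/(_ _ r0) := iterate_residual; apply: filterS => n.
  by rewrite sub0r normrN normr_id.
have : \forall n \near \oo, dot (f q - q) (z n - q) <= d.
  near=> n; apply: hr; [apply: iterate_in|..]; by near: n.
move/near_succ; apply: filterS => n h.
by rewrite sub0r normrN ger0_norm ?le_max ?lexx// ge_max h ltW.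
Unshelve. all: by end_near. Qed.

(** The obtuse angle inequality |z_{n+1} - q|^2 <= <v_n - q, z_{n+1} - q>, where v_n is
    the projected point, is used instead of nonexpansiveness so that f q - q only
    enters through its inner product with z_{n+1} - q. *)
Lemma near_iterate_sq_dist : \forall n \near \oo,
  `|z n.+1 - q| ^+ 2 <= (1 - (1 - rho) * alpha n) * `|z n - q| ^+ 2
    + (2 * (alpha n * Num.max 0 (dot (f q - q) (z n.+1 - q))) + 2 * M * `|e n|).
Proof.
near=> n.
have n1 : (1 <= n)%N by near: n.
have [w1 w2] : `|w n - q| <= `|T n (z n) - q| /\ `|T n (z n) - q| <= `|z n - q|.
  by near: n; exact: near_w_dist.
have zn1 : `|z n.+1 - q| <= M by near: n; exact: (near_succ zM).
have /andP[a0 a1] := alpha_itv n.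
have a2 : 0 <= 1 - alpha n by rewrite subr_ge0.
have := metric_proj_obtuse norm_dot Q_nonempty Q_closed Q_convex
  (alpha n *: f (z n) + (1 - alpha n) *: w n + e n) Qq.
rewrite -z_step//.
set p := z n.+1; set D := Num.max 0 _ => h.
have hD : dot (f q - q) (p - q) <= D by rewrite /D le_max lexx orbT.
have h1 := cauchy_schwarz norm_dot (f (z n) - f q) (p - q).
have h2 := cauchy_schwarz norm_dot (w n - q) (p - q).
have h3 := cauchy_schwarz norm_dot (e n) (p - q).
have pq0 : 0 <= `|p - q| by [].
have h4 := ler_wpM2r pq0 (f_lip (iterate_in n1) Qq).
have h5 := ler_wpM2r pq0 (le_trans w1 w2).
have h6 := ler_wpM2l (normr_ge0 (e n)) zn1.
have h7 := ler_wpM2l (ltW a0) (le_trans h1 h4).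
have h8 := ler_wpM2l a2 (le_trans h2 h5).
have h9 := ler_wpM2l (ltW a0) hD.
have split_sq : `|p - q| ^+ 2 <= alpha n * dot (f (z n) - f q) (p - q)
    + alpha n * dot (f q - q) (p - q) + (1 - alpha n) * dot (w n - q) (p - q)
    + dot (e n) (p - q).
  move: h; rewrite (normsqE norm_dot) !dot_expand; lra.
have k0 : 0 <= 1 - (1 - rho) * alpha n.
  by case/andP: gam_itv => g0 g1; nra.
have k1 : 0 <= (1 - rho) * alpha n by case/andP: gam_itv => g0 g1; rewrite mulr_ge0// ltW.
have h10 := mulr_ge0 k0 (sqr_ge0 (`|z n - q| - `|p - q|)).
have h11 := mulr_ge0 k1 (sqr_ge0 `|p - q|).
lra.
Unshelve. all: by end_near. Qed.

Lemma iterate_cvg : z n @[n --> \oo] --> q.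
Proof.
have xneg : negligible alpha (fun n =>
    2 * (alpha n * Num.max 0 (dot (f q - q) (z n.+1 - q))) + 2 * M * `|e n|).
  apply: negligibleD; last by apply: negligibleZ => //; rewrite mulr_ge0.
  by apply: negligibleZ => //; apply: negligible_vanishing; exact: iterate_VI_limit.
have sq0 : `|z n - q| ^+ 2 @[n --> \oo] --> 0.
  apply: (recursion_vanishing alpha_itv gam_itv xneg) => //.
  exact: near_iterate_sq_dist.
apply/cvgrPdist_lt => d d0.
have /cvgrPdist_lt/(_ _ (exprn_gt0 2 d0)) := sq0; apply: filterS => n.
by rewrite sub0r normrN ger0_norm ?sqr_ge0// ltr_sqr ?nnegrE ?(ltW d0)// distrC.
Qed.
End Iteration.

Theorem corollary4p1 (R : realType) (H : completeNormedModType R)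
    (dot : {dot H for idfun})
    (norm_dot : forall x : H, `|x| = Num.sqrt (dot x x))
    (Q : set H) (Q_nonempty : Q !=set0) (Q_closed : closed Q)
    (Q_convex : convex_set (Q : set (convex_lmodType H)))
    (S : {fun Q >-> Q}) (S_nonexpansive : nonexpansive Q S)
    (f : {fun Q >-> Q}) (rho : R) (rho_itv : 0 <= rho < 1)
    (f_contraction : rho.-lipschitz_Q f)
    (phi : H -> R)
    (phi_convex : convex_function (Q : set (convex_lmodType H)) (phi : _ -> R^o))
    (grad_phi : H -> H) (phi_C1 : C1_on dot Q phi grad_phi)
    (L : R) (L_gt0 : 0 < L) (grad_lipschitz : L.-lipschitz_Q grad_phi)
    (F_nonempty : fixed_points Q S `&` argmin Q phi !=set0)
    (alpha lambda : nat -> R) (e : nat -> H)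
    (alpha_itv : forall n, 0 < alpha n <= 1)
    (lambda_itv : forall n, 0 <= lambda n <= 2 / L)
    (alpha_to0 : alpha n @[n --> \oo] --> 0)
    (alpha_sum : series alpha n @[n --> \oo] --> +oo)
    (lambda_lim : [/\ 0 < limn_inf lambda,
      limn_inf lambda <= limn_sup lambda & limn_sup lambda < 2 / L])
    (alpha_var :
      (alpha n.+1 - alpha n) / alpha n @[n --> \oo] --> 0 \/
      cvgn (series (fun n => `|alpha n.+1 - alpha n|)))
    (lambda_var :
      (lambda n.+1 - lambda n) / alpha n @[n --> \oo] --> 0 \/
      cvgn (series (fun n => `|lambda n.+1 - lambda n|)))
    (e_small :
      `|e n| / alpha n @[n --> \oo] --> 0 \/
      cvgn (series (fun n => `|e n|))) :
  exists qstar : H,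
    VI_solutions dot (fixed_points Q S `&` argmin Q phi) f = [set qstar] /\
    forall z : nat -> H, Q (z 1%N) ->
      (forall n, (1 <= n)%N ->
        z n.+1 = metric_proj Q
          (alpha n *: f (z n)
           + (1 - alpha n) *:
               S (metric_proj Q (z n - lambda n *: grad_phi (z n)))
           + e n)) ->
      z n @[n --> \oo] --> qstar.
Proof.
have [phi_grad _] := phi_C1.
have Sin x : Q x -> Q (S x) by exact: funS.
have fin x : Q x -> Q (f x) by exact: funS.
have flip x y : Q x -> Q y -> `|f x - f y| <= rho * `|x - y|.
  by move=> Qx Qy; exact: (f_contraction (x, y) (conj Qx Qy)).
have glip x y : Q x -> Q y -> `|grad_phi x - grad_phi y| <= L * `|x - y|.
  by move=> Qx Qy; exact: (grad_lipschitz (x, y) (conj Qx Qy)).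
have alpha_gt0 n : 0 < alpha n by case/andP: (alpha_itv n).
have alpha_neg := negligible_dichotomy alpha_gt0 alpha_var.
have lambda_neg := negligible_dichotomy alpha_gt0 lambda_var.
have e_neg : negligible alpha (fun n => `|e n|).
  have e_dich : `|e n| / alpha n @[n --> \oo] --> 0 \/
      cvgn (series (fun n => `| `|e n| |)).
    by case: e_small => h; [left|right; under eq_fun do rewrite normr_id].
  have := negligible_dichotomy alpha_gt0 e_dich.
  by under eq_fun do rewrite normr_id.
have [inf_gt0 _ sup_lt] := lambda_lim.
(* lo > 0 and hi < 2 / L bound the steps from some rank on *)
pose lo := limn_inf lambda / 2; pose hi := (limn_sup lambda + 2 / L) / 2.
have lo_gt0 : 0 < lo by rewrite divr_gt0.
have near_lo : \forall n \near \oo, lo <= lambda n.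
  by apply: (near_le_limn_inf lambda_itv); rewrite /lo; lra.
have near_hi : \forall n \near \oo, lambda n <= hi.
  by apply: (near_ge_limn_sup lambda_itv); rewrite /hi; lra.
have hi_lt : hi < 2 / L by rewrite /hi; lra.
have lambda_near : \forall n \near \oo, lo <= lambda n <= hi.
  by near=> n; apply/andP; split; near: n.
have lo_itv : 0 <= lo <= 2 / L.
  have [n /andP[h1 h2]] := filter_ex lambda_near.
  by rewrite (ltW lo_gt0) (le_trans h1)// (le_trans h2)// ltW.
(* lo is below all late steps, so its residual is controlled by theirs *)
pose T := gradient_proj Q grad_phi lo.
have Tin x : Q (T x) by exact: (gradient_proj_in norm_dot Q_nonempty Q_closed Q_convex).
have Tfix x : Q x /\ T x = x <-> argmin Q phi x.
  exact: (gradient_proj_fix norm_dot Q_nonempty Q_closed Q_convex phi_convex phi_grad).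
have T1 : nonexpansive Q T.
  exact: (gradient_proj_nonexpansive norm_dot Q_nonempty Q_closed Q_convex
    phi_convex phi_grad L_gt0 glip).
pose W x := S x + 2^-1 *: (T x - S x).
have half01 : 0 <= (2^-1 : R) <= 1 by lra.
have Win x : Q x -> Q (W x).
  by move=> Qx; apply: convex_segment => //; exact: Sin.
have W1 : nonexpansive Q W.
  move=> x y Qx Qy.
  rewrite (_ : W x - W y = 2^-1 *: (S x - S y) + 2^-1 *: (T x - T y)); last first.
    by apply: (dot_injl norm_dot) => z; rewrite /W !dot_expand; lra.
  apply: (le_trans (ler_normD _ _)); rewrite !normrZ (gtr0_norm (_ : 0 < 2^-1)) ?invr_gt0//.
  have := S_nonexpansive x y Qx Qy; have := T1 x y Qx Qy; lra.
have WF : fixed_points Q W = fixed_points Q S `&` argmin Q phi.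
  apply/seteqP; split=> x.
    move=> Wx; have [p [Sp /Tfix Tp]] := F_nonempty.
    have [Sx Tx] := fixed_points_average norm_dot S_nonexpansive T1 Sp Tp Wx.
    by split; [split => //; exact: Wx.1|apply/Tfix; split => //; exact: Wx.1].
  move=> [[Qx Sx] /Tfix[_ Tx]]; split => //.
  by rewrite /W Sx Tx subrr scaler0 addr0.
have W0 : fixed_points Q W !=set0 by rewrite WF.
have [q [qVI q_approx]] := viscosity_point norm_dot Q_nonempty Q_closed Q_convex
  fin rho_itv flip Win W1 W0.
rewrite WF in qVI.
exists q; split.
  apply/seteqP; split=> [q' q'VI|q' ->//].
  apply: (VI_solutions_unique norm_dot rho_itv flip) q'VI qVI.
  by move=> x [[]].
move=> z z1 z_step; have [[Sq qmin] _] := qVI.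
have [M zM] := iterate_bounded norm_dot Q_nonempty Q_closed Q_convex
  S_nonexpansive rho_itv flip phi_convex phi_grad L_gt0 glip alpha_itv
  lambda_itv e_neg lo_gt0 lambda_near Sq qmin z1 z_step.
exact: (iterate_cvg norm_dot Q_nonempty Q_closed Q_convex Sin
  S_nonexpansive rho_itv flip phi_convex phi_grad L_gt0 glip alpha_itv
  lambda_itv alpha_to0 alpha_sum alpha_neg lambda_neg e_neg lo_gt0 hi_lt
  lambda_near Sq qmin z1 z_step zM q_approx).
Unshelve. all: by end_near. Qed.
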